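(* Let $w\in\mathbf{F}_r$ and let $m\in\mathbb{Z}_{\ge2}$ or $m=\infty$. If $m\in\mathbb{Z}_{\ge 2}$ let $G(N)=C_m\wr S_N$, and if $m=\infty$ let $G(N)=\mathcal{S}^1\wr S_N$. Then $$\mathcal{T}r_w(G(N))=C\cdot N^{\chi_m(w)}+O\left(N^{\chi_m(w)-1}\right)\qquad (N\to\infty),$$ where $C$ is a natural number (in particular finite) equal to the number of subgroups $H\le\mathbf{F}_r$ with $\chi_m(w)=1-\mathrm{rank}(H)$ and $w\in K_m(H)$. In particular, $\mathcal{T}r_w(G(N))$ vanishes if $\chi_m(w)=-\infty$.
   Context: $\mathbf{F}_r$ is the free group with basis $x_1,\dots,x_r$. $\mathcal{S}^1\wr S_N$ denotes the subgroup of $\mathrm{GL}_N(\mathbb{C})$ consisting of matrices with exactly one non-zero entry in every row and every column, all non-zero entries having absolute value $1$. For an integer $m\ge2$, $C_m\wr S_N$ denotes the subgroup of $\mathcal{S}^1\wr S_N$ of matrices all of whose non-zero entries are $m$-th roots of unity. For a compact matrix group $G$, $\mathcal{T}r_w(G)$ denotes the expected value of the trace of $w(A_1,\dots,A_r)$, where $A_1,\dots,A_r$ are independent Haar-distributed random elements of $G$ substituted for $x_1,\dots,x_r$. For a free group $\mathbf{F}$ and $m\in\mathbb{Z}_{\ge2}$, $K_m(\mathbf{F})$ is the kernel of the homomorphism from $\mathbf{F}$ to $C_m^{\mathrm{rank}(\mathbf{F})}$ (with $C_m=\mathbb{Z}/m\mathbb{Z}$) mapping the elements of a basis of $\mathbf{F}$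 to distinct elements of a standard generating set; i.e. it is the set of elements in which the total exponent of every basis element is divisible by $m$ (this does not depend on the basis). Also $K_\infty(\mathbf{F})=[\mathbf{F},\mathbf{F}]$. For $m\in\mathbb{Z}_{\ge2}\cup\{\infty\}$, $$\chi_m(w)=1-\min\{\mathrm{rank}(H)\mid H\le\mathbf{F}_r,\ w\in K_m(H)\},$$ with $\chi_m(w)=-\infty$ if the set is empty. When $\chi_m(w)=-\infty$, expressions $N^{-\infty}$ are read as $0$. The notation $f=O(g)$ means $|f(N)|\le c\,g(N)$ for some constant $c>0$ and every large enough $N$. *)

(* Defs.v *)
From HB Require Import structures.
From mathcomp Require Import all_boot all_order all_algebra.
From mathcomp Require Import complex.
From mathcomp Require Import all_classical all_reals all_analysis.
Set Implicit Arguments.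
Unset Strict Implicit.
Unset Printing Implicit Defensive.
Import Order.TTheory GRing.Theory Num.Theory.
Import numFieldNormedType.Exports.
Local Open Scope classical_set_scope.
Local Open Scope ring_scope.

(* The free group on X as the set of reduced words; a letter (x, false) stands
   for x and (x, true) for x^-1. *)

Definition flip {X : Type} (a : X * bool) : X * bool := (a.1, ~~ a.2).

Definition reduced {X : eqType} (s : seq (X * bool)) : bool :=
  sorted (fun a b => b != flip a) s.

Record free_group (X : choiceType) : Type := FreeGroup {
  word :> seq (X * bool);
  _ : reduced word }.

HB.instance Definition _ (X : choiceType) := [isSub for @word X].
HB.instance Definition _ (X : choiceType) := [Choice of free_group X by <:].

Section FreeGroupLaw.
Variable X : choiceType.
Implicit Types (a b : X * bool) (s t : seq (X * bool)) (u v : free_group X).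

Definition push a s :=
  if s is b :: s' then if b == flip a then s' else a :: s else [:: a].

Definition reduce s := foldr push [::] s.

Lemma flipK : involutive (@flip X).
Proof. by case=> x b; rewrite /flip negbK. Qed.

Lemma push_reduced a s : reduced s -> reduced (push a s).
Proof.
case: s => [|b s] //= hs; case: ifP => [_|/negbT hb]; last by rewrite /= hb.
exact: path_sorted hs.
Qed.

Lemma foldr_push_reduced s t : reduced t -> reduced (foldr push t s).
Proof. by move=> ht; elim: s => //= a s IHs; apply: push_reduced. Qed.

Lemma push_flip a s : reduced s -> push (flip a) (push a s) = s.
Proof.
case: s => [|b s] /= hs; first by rewrite flipK eqxx.
case: eqP => [e|_] /=; last by rewrite flipK eqxx.
subst b; case: s hs => [|c s] //= /andP[hc _].
by rewrite (negbTE hc).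
Qed.

Lemma reduce_id s : reduced s -> reduce s = s.
Proof.
elim: s => //= a s IHs hs; rewrite (IHs (path_sorted hs)).
by case: s hs {IHs} => //= b s /andP[/negbTE -> _].
Qed.

Lemma foldr_push_push t a s : reduced t -> reduced s ->
  foldr push t (push a s) = push a (foldr push t s).
Proof.
move=> ht; case: s => [|b s] //= hs; case: eqP => // ->.
have := push_flip (flip a) (foldr_push_reduced s ht).
by rewrite /= flipK => ->.
Qed.

Lemma foldr_push_reduce t s : reduced t ->
  foldr push t (reduce s) = foldr push t s.
Proof.
move=> ht; elim: s => //= a s IHs.
by rewrite foldr_push_push ?IHs // foldr_push_reduced.
Qed.

Lemma word_reduced u : reduced (word u).
Proof. by case: u. Qed.

Lemma fg_mul_subproof u v : reduced (foldr push (word v) (word u)).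
Proof. exact/foldr_push_reduced/word_reduced. Qed.

Definition fg_mul u v : free_group X := FreeGroup (fg_mul_subproof u v).

Definition fg_one : free_group X := FreeGroup (isT : reduced [::]).

Lemma fg_inv_subproof u : reduced (rev (map flip (word u))).
Proof.
rewrite /reduced rev_sorted sorted_map.
apply: sub_sorted (word_reduced u) => a b /=.
by apply: contra => /eqP ->; rewrite !flipK.
Qed.

Definition fg_inv u : free_group X := FreeGroup (fg_inv_subproof u).

Lemma fg_mulA : associative fg_mul.
Proof.
move=> u v z; apply: val_inj => /=.
elim: (word u) => //= a s ->.
by rewrite foldr_push_push ?word_reduced // foldr_push_reduced ?word_reduced.
Qed.

Lemma fg_mul1 : left_id fg_one fg_mul.
Proof. by move=> u; apply: val_inj. Qed.

Lemma fg_mulr1 : right_id fg_one fg_mul.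
Proof.
by move=> u; apply: val_inj; rewrite /= -/(reduce _) reduce_id ?word_reduced.
Qed.

Lemma foldr_push_rev_flip t s : reduced t ->
  foldr push (foldr push t s) (rev (map flip s)) = t.
Proof.
move=> ht; elim: s => //= a s IHs.
by rewrite rev_cons foldr_rcons push_flip ?foldr_push_reduced.
Qed.

Lemma fg_mulV : left_inverse fg_one fg_inv fg_mul.
Proof.
move=> u; apply: val_inj => /=.
by rewrite -{1}(reduce_id (word_reduced u)) foldr_push_rev_flip.
Qed.

Lemma fg_invK : involutive fg_inv.
Proof.
move=> u; apply: val_inj => /=.
by rewrite map_rev revK -map_comp map_id_in // => a _; rewrite /= flipK.
Qed.

Lemma fg_mulrV : right_inverse fg_one fg_inv fg_mul.
Proof. by move=> u; rewrite -{1}(fg_invK u) fg_mulV. Qed.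

HB.instance Definition _ := isGroup.Build (free_group X)
  fg_mulA fg_mul1 fg_mulr1 fg_mulV fg_mulrV.

Definition gen (x : X) : free_group X :=
  FreeGroup (isT : reduced [:: (x, false)]).

(* Total exponent of x. *)
Definition expsum (x : X) u : int := \sum_(a <- word u | a.1 == x) (-1) ^+ a.2.

(* Substitution of f x for every basis element x. *)
Definition subst_word {T : Type} (one : T) (mul : T -> T -> T) (inv : T -> T)
    (f : X -> T) u : T :=
  \big[mul/one]_(a <- word u) (if a.2 then inv (f a.1) else f a.1).

End FreeGroupLaw.

Section Subgroups.
Variable G : groupType.
Implicit Types (H S : set G) (g h : G).
Local Open Scope group_scope.

Definition is_subgroup H : Prop :=
  [/\ H 1, forall g h, H g -> H h -> H (g * h) & forall g, H g -> H g^-1].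

Definition generated S : set G :=
  [set g | forall H, is_subgroup H -> S `<=` H -> H g].

Definition derived H : set G :=
  generated [set [~ g, h]%g | g in H & h in H].

(* The homomorphism from the free group on I that maps each i to b i. *)
Definition extend (I : choiceType) (b : I -> G) : free_group I -> G :=
  subst_word 1 *%g (fun g => g^-1) b.

Definition is_basis (I : choiceType) (b : I -> G) H : Prop :=
  injective (extend b) /\ range (extend b) = H.

Definition has_rank H (n : nat) : Prop := exists b : 'I_n -> G, is_basis b H.

End Subgroups.

Lemma gen_basis (X : choiceType) : is_basis (@gen X) [set: free_group X].
Proof.
have genE u : extend (@gen X) u = u.
  have pushE (a : X * bool) (z : free_group X) :
    word ((if a.2 then (gen a.1)^-1 else gen a.1) * z)%g = push a (word z).
    by case: a => x [].
  have foldE (s : seq (X * bool)) : word (\big[*%g/1%g]_(a <- s)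
      (if a.2 then (gen a.1)^-1 else gen a.1)%g) = reduce s.
    elim: s => [|a s IHs]; first by rewrite big_nil.
    by rewrite big_cons -[reduce _]/(push a (reduce s)) -IHs; apply: pushE.
  by apply: val_inj; rewrite /= foldE reduce_id ?word_reduced.
split=> [u v|]; first by rewrite !genE.
by apply/seteqP; split=> // u _; exists u.
Qed.

(* The parameter m is [Some k] for the integer k and [None] for infinity.
   The index type I is arbitrary, so that H may have infinite rank. *)
Definition Kker (G : groupType) (m : option nat) (H : set G) : set G :=
  if m is Some k then
    [set g | exists (I : choiceType) (b : I -> G), is_basis b H /\
       exists u, g = extend b u /\ forall i, (k%:Z %| expsum i u)%Z]
  else derived H.

Definition Kranks (G : groupType) (m : option nat) (w : G) : set nat :=
  [set n | exists H : set G, [/\ is_subgroup H, has_rank H n & Kker m H w]].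

(* One minus the least element of [Kranks m w], and -oo when that set is
   empty. *)
Definition chi (G : groupType) (m : option nat) (w : G) : \bar int :=
  match pselect (exists n, `[< Kranks m w n >]) with
  | left h => (1 - (ex_minn h)%:Z)%:E
  | right _ => -oo%E
  end.

Definition Kwitness (G : groupType) (m : option nat) (w : G) : set (set G) :=
  [set H | [/\ is_subgroup H, Kker m H w &
     exists n, has_rank H n /\ chi m w = (1 - n%:Z)%:E]].

(* N ^ e, with the convention N ^ (-oo) = 0; the value at +oo is junk, as [chi]
   never takes it. *)
Definition epow {K : fieldType} (N : nat) (e : \bar int) : K :=
  if e is k%:E%E then N%:R ^ k else 0.

(* The usual topology of R[i], induced by the complex modulus; square matrices
   over R[i] then get their topology from the library. *)
HB.instance Definition _ (R : realType) :=
  PseudoPointedMetric.copy R[i] R[i]^o.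

(* Complex square matrices with the Borel sigma-algebra. *)
Definition cmatrix (R : realType) (N : nat) :=
  g_sigma_algebraType (@open 'M[R[i]]_N).

HB.instance Definition _ (R : realType) (N : nat) :=
  Measurable.on (cmatrix R N).

(* The monomial matrix groups: [wreath R None N] is S^1 wr S_N and
   [wreath R (Some k) N] is C_k wr S_N. *)
Definition wreath (R : realType) (m : option nat) (N : nat) :
    set (cmatrix R N) :=
  [set M : 'M[R[i]]_N |
    [/\ forall i, exists! j, M i j != 0,
        forall j, exists! i, M i j != 0,
        forall i j, M i j != 0 -> `|M i j| = 1 &
        if m is Some k then forall i j, M i j != 0 -> M i j ^+ k = 1
        else True]].
Arguments wreath R m N : clear implicits.

(* The Haar probability measure of the compact group G, seen as a Borel measure
   on all matrices that is carried by G; the set below is g^-1 B. *)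
Definition is_haar (R : realType) (N : nat) (G : set (cmatrix R N))
    (mu : probability (cmatrix R N) R) : Prop :=
  mu G = 1%E /\
  forall (g : cmatrix R N) (B : set (cmatrix R N)), G g -> measurable B ->
    mu [set M : cmatrix R N | B (g *m M)] = mu B.

Section RandomMatrices.
Context (R : realType) (d : measure_display) (T : measurableType d).
Context (P : probability T R) (N r : nat).
Implicit Type A : 'I_r -> {RV P >-> cmatrix R N}.

(* Some of the B i may be the whole space, so this covers all subfamilies. *)
Definition independent_RVs A : Prop :=
  forall B : 'I_r -> set (cmatrix R N), (forall i, measurable (B i)) ->
    P [set t | forall i, B i (A i t)] = (\prod_(i < r) P (A i @^-1` B i))%E.

Definition haar_iid (G : set (cmatrix R N)) A : Prop :=
  (forall i, is_haar G (distribution P (A i))) /\ independent_RVs A.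

Definition complex_expectation (f : T -> R[i]) : R[i] :=
  (fine 'E_P[fun t => complex.Re (f t)]
     +i* fine 'E_P[fun t => complex.Im (f t)])%C.

(* The expected trace of w (A 0, ..., A (r-1)). *)
Definition mean_trace (w : free_group 'I_r) A : R[i] :=
  complex_expectation (fun t =>
    \tr (subst_word 1%:M mulmx invmx (fun i => A i t : 'M[R[i]]_N) w)).

End RandomMatrices.

(* Main.v *)
Require Import Defs.
From HB Require Import structures.
From mathcomp Require Import all_boot all_order all_algebra all_fingroup.
From mathcomp Require Import complex cyclic separable cyclotomic.
From mathcomp Require Import all_classical all_reals all_analysis.
From mathcomp Require Import measurable_realfun.
From mathcomp Require Import zify ring lra.
Import Defs.
Import Order.TTheory GRing.Theory Num.Theory.
Import numFieldNormedType.Exports.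
Set Implicit Arguments.
Unset Strict Implicit.
Unset Printing Implicit Defensive.

(** A product of monomial matrices is monomial, so the trace of w(A_1, ..., A_r)
is a sum over the starting points i fixed by the permutation of w, and the
term of i is the product of the phases of the edges that the walk of w from i
crosses. Translating the A_j by independent uniform elements of a finite
monomial group does not change their joint law, and averages the phases of the
edges independently: only those walks survive which are closed and cross every
edge a signed number of times divisible by m (equal to 0 if m is infinite).
Hence N!^r times the mean trace is the number of pairs of a point i and an
r-tuple of permutations for which the walk of w from i is such a balanced loop
([mean_trace_balanced_loops]).

The pattern Q of a walk is the partition of its positions by visited vertices;
it determines the number V of vertices, the number E_x of edges with label x,
and whether the walk is a balanced loop. Counting the injections of the vertices
and the permutations that extend the given edges, the pairs with pattern Q
contribute N^_V / prod_x N^_(E_x) = N^(V - E) (1 + O(1/N)) to the mean trace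
([card_pattern], [pattern_term_asymp]), where E is the sum of the E_x.

It remains to match patterns with subgroups. The graph traced by a walk with
pattern Q has a fundamental group, which depends on Q only: the subgroup
generated by the quotients of prefixes of w that end at the same vertex
([walk_group]). The edges outside a spanning tree give it a basis of 1 + E - V
elements, and the exponents of w in this basis are the crossing numbers of these
edges, so that w lies in its subgroup K_m ([admissible_group]). Conversely let
w lie in K_m(H) for a subgroup H of rank n. The walk of w in the graph of the
cosets of H is a balanced loop: the characters of H vanish on w modulo m, and
the indicator of an edge extends to a character ([balanced_Kker]). The subgroup
of its pattern is contained in H, it has rank at most n, since labels in F_2 on
the edges outside a tree give distinct characters of H ([rank_le]), and it is H
if its rank is n: a reduced loop which leaves the graph of w would create a
further cycle ([walk_group_full]). So the patterns of least rank are in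
bijection with the subgroups that the theorem counts. *)

(** * Words and reversible steps *)

Section Words.
Local Open Scope group_scope.
Variable X : choiceType.
Implicit Types (a : X * bool) (s t l : seq (X * bool)) (u v : free_group X).

(** The steps of such a system are the action of the letters from the right, so that
the end of a run depends only on the element of the free group that is read. *)
Definition reversible (Y : Type) (st : Y -> X * bool -> Y) :=
  forall y a, st (st y a) (flip a) = y.

Section Reversible.
Variables (Y : Type) (st : Y -> X * bool -> Y).
Hypothesis stK : reversible st.

Lemma foldl_push y a s : foldl st y (push a s) = foldl st (st y a) s.
Proof. by case: s => [|b s] //=; case: eqP => // ->; rewrite stK. Qed.

(** A letter followed by its inverse undoes itself, hence reduction does not change
the end of a run. *)
Lemma foldl_foldr_push y s t : foldl st y (foldr (@push X) t s) = foldl st (foldl st y s) t.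
Proof. by elim: s y => //= a s IHs y; rewrite foldl_push IHs. Qed.

Lemma foldl_wordM y u v :
  foldl st y (word (u * v)) = foldl st (foldl st y (word u)) (word v).
Proof. exact: foldl_foldr_push. Qed.

Lemma foldl_wordV y u : foldl st (foldl st y (word u)) (word u^-1) = y.
Proof. by rewrite -foldl_wordM mulgV. Qed.

Lemma foldl_wordVV y u : foldl st (foldl st y (word u^-1)) (word u) = y.
Proof. by rewrite -foldl_wordM mulVg. Qed.

Lemma foldl_word_gen y x : foldl st y (word (gen x)) = st y (x, false).
Proof. by []. Qed.

End Reversible.

Definition letter (G : groupType) (f : X -> G) a : G :=
  if a.2 then (f a.1)^-1 else f a.1.

Definition wordprod (G : groupType) (f : X -> G) s : G :=
  \big[*%g/1]_(a <- s) letter f a.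

Section Wordprod.
Variables (G : groupType) (f : X -> G).

Lemma extendE u : extend f u = wordprod f (word u).
Proof. by []. Qed.

Lemma letter_flip a : letter f (flip a) = (letter f a)^-1.
Proof. by rewrite /letter /flip; case: a => x [] /=; rewrite ?invgK. Qed.

Lemma wordprod_cons a s : wordprod f (a :: s) = letter f a * wordprod f s.
Proof. exact: big_cons. Qed.

Lemma wordprod_cat s t : wordprod f (s ++ t) = wordprod f s * wordprod f t.
Proof. exact: big_cat. Qed.

Lemma wordprod_push a s : wordprod f (push a s) = letter f a * wordprod f s.
Proof.
case: s => [|b s] /=; first exact: big_cons.
case: eqP => [->|_]; rewrite !wordprod_cons // letter_flip.
by rewrite mulgA mulgV mul1g.
Qed.

Lemma wordprod_foldr_push s t :
  wordprod f (foldr (@push X) t s) = wordprod f s * wordprod f t.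
Proof.
elim: s => [|a s IHs] /=; first by rewrite /wordprod big_nil mul1g.
by rewrite wordprod_push IHs wordprod_cons mulgA.
Qed.

Lemma extendM u v : extend f (u * v) = extend f u * extend f v.
Proof. exact: wordprod_foldr_push. Qed.

Lemma extend1 : extend f 1 = 1.
Proof. exact: big_nil. Qed.

Lemma extendV u : extend f u^-1 = (extend f u)^-1.
Proof. by apply: (mulIg (extend f u)); rewrite -extendM !mulVg extend1. Qed.

Lemma extend_gen x : extend f (gen x) = f x.
Proof. by rewrite /extend /subst_word big_seq1. Qed.

Lemma extend_letter a : extend f (letter (@gen X) a) = letter f a.
Proof. by rewrite /letter; case: a.2; rewrite ?extendV extend_gen. Qed.

End Wordprod.

Lemma word_letter a : word (letter (@gen X) a) = [:: a].
Proof. by case: a => x []. Qed.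

Lemma word_wordprod s : word (wordprod (@gen X) s) = reduce s.
Proof.
elim: s => [|a s IHs]; first by rewrite /wordprod big_nil.
rewrite wordprod_cons -[reduce _]/(push a (reduce s)) -IHs.
by case: a => x [].
Qed.

Lemma wordprod_word u : wordprod (@gen X) (word u) = u.
Proof. by apply: val_inj; rewrite /= word_wordprod reduce_id ?word_reduced. Qed.

Lemma foldl_wordprod (Y : Type) (st : Y -> X * bool -> Y) y s : reversible st ->
  foldl st y (word (wordprod (@gen X) s)) = foldl st y s.
Proof. by move=> stK; rewrite word_wordprod (foldl_foldr_push stK). Qed.

Lemma free_group_ind (K : free_group X -> Prop) :
  K 1 -> (forall a u, K u -> K (letter (@gen X) a * u)) -> forall u, K u.
Proof.
move=> K1 KM u; rewrite -(wordprod_word u).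
elim: (word u) => [|a s IHs]; first by rewrite /wordprod big_nil.
by rewrite wordprod_cons; exact: KM.
Qed.

Section Expsum.
Local Open Scope ring_scope.

Definition exponent (x : X) s : int := \sum_(a <- s | a.1 == x) (-1) ^+ a.2.

Lemma exponent_cons x a s :
  exponent x (a :: s) = (if a.1 == x then (-1) ^+ a.2 else 0) + exponent x s.
Proof. by rewrite /exponent big_cons; case: eqP; rewrite ?add0r. Qed.

Lemma exponent_push x a s : exponent x (push a s) = exponent x (a :: s).
Proof.
case: s => [|b s] //=; case: eqP => // ->; rewrite !exponent_cons /=.
by case: ifP => _; rewrite ?add0r // addrA; case: a.2; rewrite /= ?addNr ?addrN add0r.
Qed.

Lemma expsumM x u v : expsum x (u * v)%g = expsum x u + expsum x v.
Proof.
rewrite -![expsum _ _]/(exponent _ (word _)) /=.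
elim: (word u) => [|a s IHs] /=; first by rewrite {2}/exponent big_nil add0r.
by rewrite exponent_push !exponent_cons IHs addrA.
Qed.

Lemma expsum1 x : expsum x (1%g : free_group X) = 0.
Proof. exact: big_nil. Qed.

Lemma expsumV x u : expsum x u^-1%g = - expsum x u.
Proof. by apply/eqP; rewrite -addr_eq0 -expsumM mulVg expsum1. Qed.

Lemma expsum_gen (x y : X) : expsum x (gen y) = (y == x)%:R.
Proof. by rewrite /expsum /= big_cons big_nil addr0; case: eqP. Qed.

End Expsum.

End Words.

(** * Subgroups generated by families and by commutators *)

Section Subgroups.
Local Open Scope classical_set_scope.
Local Open Scope group_scope.
Variable G : groupType.
Implicit Types (H S : set G).

Lemma subgroupVM H g h : is_subgroup H -> H g -> H h -> H (g * h^-1).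
Proof. by case=> _ HM HV Hg Hh; apply: HM => //; exact: HV. Qed.

Lemma generated_subgroup S : is_subgroup (generated S).
Proof.
split=> [H [] //|g h Sg Sh H sH SH|g Sg H sH SH].
  by have [_ HM _] := sH; apply: HM; [exact: Sg|exact: Sh].
by have [_ _ HV] := sH; apply: HV; exact: Sg.
Qed.

Lemma sub_generated S : S `<=` generated S.
Proof. by move=> g Sg H _; exact. Qed.

Lemma range_extend_subgroup (I : choiceType) (b : I -> G) : is_subgroup (range (extend b)).
Proof.
split=> [|_ _ [u _ <-] [v _ <-]|_ [u _ <-]]; first by exists 1; rewrite // extend1.
  by exists (u * v); rewrite // extendM.
by exists u^-1; rewrite // extendV.
Qed.

Lemma subgroup_extend (I : choiceType) (b : I -> G) H : is_subgroup H ->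
  (forall i, H (b i)) -> range (extend b) `<=` H.
Proof.
move=> [H1 HM HV] Hb _ [u _ <-]; elim/free_group_ind: u => [|a u IHu]; first by rewrite extend1.
rewrite extendM extend_letter; apply: HM => //.
by rewrite /letter; case: a.2; [apply: HV|].
Qed.

(** The exponents being zero, the first letter a of the word has an inverse further on.
Since a s1 a^-1 s2 is the product of a commutator and of s1 s2, the two letters
can be removed modulo the derived subgroup. *)
Lemma derived_wordprod (I : choiceType) (b : I -> G) H (s : seq (I * bool)) :
  is_subgroup H -> (forall i, H (b i)) -> (forall i, exponent i s = 0%R) ->
  derived H (wordprod b s).
Proof.
move=> sH Hb; have [H1 HM HV] := sH.
have [D1 DM DV] := generated_subgroup [set [~ g, h]%g | g in H & h in H].
have Hl c : H (letter b c) by rewrite /letter; case: c.2; [apply: HV|].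
have Hw t : H (wordprod b t).
  elim: t => [|c t IHt]; first by rewrite /wordprod big_nil.
  by rewrite wordprod_cons; apply: HM.
have [n] := ubnP (size s).
elim: n s => // n IHn [|a s] lt_n e0; first by rewrite /wordprod big_nil.
move: lt_n e0; have [/splitPr[s1 s2]|aN] := boolP (flip a \in s); last first.
  move=> _ e0.
  (* Otherwise every occurrence of the basis element of a has the sign of a, and its
  total exponent cannot vanish. *)
  have [k kE] : exists k : nat, exponent a.1 s = ((-1) ^+ a.2 * k%:Z)%R.
    elim: s aN {e0} => [|c s IHs]; first by exists 0%N; rewrite /exponent big_nil mulr0.
    rewrite inE negb_or => /andP[ca /IHs[k kE]].
    rewrite exponent_cons kE; case: eqP => [c1|_]; last by exists k; rewrite add0r.
    exists k.+1; have -> : c.2 = a.2.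
      move: ca; rewrite /flip; case: c c1 => x e /= ->.
      by rewrite xpair_eqE eqxx /=; case: e a.2 => [] [].
    by rewrite intS mulrDr mulr1.
  have := e0 a.1; rewrite exponent_cons eqxx kE -[X in (X + _)%R]mulr1 -mulrDr => /eqP.
  by rewrite mulf_eq0 signr_eq0.
rewrite -cat_cons => lt_n e0.
have -> : wordprod b ((a :: s1) ++ flip a :: s2) =
    [~ (letter b a)^-1, (wordprod b s1)^-1] * wordprod b (s1 ++ s2).
  rewrite !wordprod_cat !wordprod_cons letter_flip /commg /conjg !invgK.
  by rewrite !mulgA mulgVK.
apply: DM.
  apply: sub_generated; exists (letter b a)^-1; first exact: HV.
  by exists (wordprod b s1)^-1; first exact: HV.
apply: IHn => [|i]; first by move: lt_n; rewrite /= !size_cat /=; lia.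
have := e0 i; rewrite /exponent !big_cat /= !big_cons /=.
by case: eqP => _ //; case: a.2; rewrite /= ?expr0 ?expr1; lia.
Qed.

Lemma derived_expsum0 (I : choiceType) (b : I -> G) H (u : free_group I) : is_subgroup H ->
  (forall i, H (b i)) -> (forall i, expsum i u = 0%R) -> derived H (extend b u).
Proof. by move=> sH Hb u0; apply: derived_wordprod. Qed.

End Subgroups.

(** * Walks in labelled graphs *)

Definition distinct (U : eqType) (s : seq U) := size (undup s).

Lemma distinct_rcons (U : eqType) (W : seq U) w :
  distinct (rcons W w) = ((w \notin W) + distinct W)%N.
Proof.
have eq_W : rcons W w =i w :: W by move=> z; rewrite mem_rcons.
by rewrite /distinct (perm_size (perm_undup eq_W)) /=; case: (w \in W).
Qed.

Lemma distinct_map (U U' : eqType) (f : U -> U') (s : seq U) :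
  {in s &, injective f} -> distinct (map f s) = distinct s.
Proof.
rewrite /distinct; elim: s => //= x s IHs finj.
have -> : (f x \in map f s) = (x \in s).
  apply/mapP/idP => [[y ys xy]|xs]; last by exists x.
  by rewrite (finj x y) ?inE ?eqxx ?ys ?orbT.
have IH : size (undup (map f s)) = size (undup s).
  by apply: IHs => y z ys zs; apply: finj; rewrite inE ?ys ?zs orbT.
by case: ifP => _ /=; rewrite IH.
Qed.

Lemma last_scanl (T1 T2 : Type) (g : T1 -> T2 -> T1) x l : last x (scanl g x l) = foldl g x l.
Proof. by elim: l x => //= a l IHl x. Qed.

Lemma scanl_cat (T1 T2 : Type) (g : T1 -> T2 -> T1) x l1 l2 :
  scanl g x (l1 ++ l2) = scanl g x l1 ++ scanl g (foldl g x l1) l2.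
Proof. by elim: l1 x => //= a l1 IHl x; rewrite IHl. Qed.

Section Walks.
Local Open Scope ring_scope.
Variable X : eqType.
Implicit Types (a : X * bool) (s : seq (X * bool)).

(** A step is recorded as a letter over the alphabet of edges: the edge that it uses,
oriented in the direction of its positive letter, and whether the step goes against
this orientation. A walk thus becomes a word in its edges. *)
Definition dart {T : Type} (u v : T) a : (X * (T * T)) * bool :=
  ((a.1, if a.2 then (v, u) else (u, v)), a.2).

Fixpoint darts {T : Type} (u : T) (vs : seq T) s : seq ((X * (T * T)) * bool) :=
  match vs, s with
  | v :: vs', a :: s' => dart u v a :: darts v vs' s'
  | _, _ => [::]
  end.

Definition edges {T : Type} (u : T) vs s := [seq d.1 | d <- darts u vs s].

(** The exponent of e in the word of darts. *)
Definition crossing {T : eqType} (u : T) vs s (e : X * (T * T)) : int :=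
  \sum_(d <- darts u vs s | d.1 == e) (-1) ^+ d.2.

(** The value [None] of m stands for infinity, and only 0 is divisible by infinity. *)
Definition divides_by (m : option nat) (z : int) : bool :=
  if m is Some k then (k%:Z %| z)%Z else z == 0.

Definition balanced {T : eqType} m (u : T) vs s :=
  all (fun e => divides_by m (crossing u vs s e)) (edges u vs s).

Lemma divides_by0 m : divides_by m 0.
Proof. by case: m => //= k; rewrite dvdz0. Qed.

Lemma crossing_notin (T : eqType) (u : T) vs s e :
  e \notin edges u vs s -> crossing u vs s e = 0.
Proof.
move=> eN; rewrite /crossing big_seq_cond big1// => d /andP[dD /eqP de].
by case/negP: eN; rewrite -de map_f.
Qed.

Lemma balancedP (T : eqType) m (u : T) vs s :
  reflect (forall e, divides_by m (crossing u vs s e)) (balanced m u vs s).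
Proof.
apply: (iffP allP) => [H e|H e _]; last exact: H.
case: (boolP (e \in edges u vs s)) => [/H//|/crossing_notin ->].
exact: divides_by0.
Qed.

Lemma size_darts (T : Type) (u : T) vs s : (size (darts u vs s) <= size s)%N.
Proof. by elim: s u vs => [|a s IHs] u [|v vs] //=; rewrite ltnS. Qed.

Lemma crossing_le (T : eqType) (u : T) vs s e :
  (`|crossing u vs s e| <= size s)%N.
Proof.
apply: leq_trans (size_darts u vs s); rewrite /crossing.
elim: (darts u vs s) => [|d D IHD]; first by rewrite big_nil.
rewrite big_cons /=; case: ifP => _; last exact: leq_trans IHD _.
rewrite -lez_nat abszE (le_trans (ler_normD _ _))// normrX normrN1 expr1n.
by rewrite -[(size D).+1]add1n PoszD lerD2l -abszE lez_nat.
Qed.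

Definition relabel {T T' : Type} (f : T -> T') (e : X * (T * T)) : X * (T' * T') :=
  (e.1, (f e.2.1, f e.2.2)).

Lemma darts_map (T T' : Type) (f : T -> T') (u : T) vs s :
  darts (f u) (map f vs) s = [seq (relabel f d.1, d.2) | d <- darts u vs s].
Proof.
elim: s u vs => [|a s IHs] u [|v vs] //=; rewrite IHs; congr cons.
by rewrite /dart /relabel /=; case: a.2.
Qed.

Lemma edges_map (T T' : Type) (f : T -> T') (u : T) vs s :
  edges (f u) (map f vs) s = map (relabel f) (edges u vs s).
Proof. by rewrite /edges darts_map -!map_comp. Qed.

Lemma edges_in (T : eqType) (u : T) vs s (e : X * (T * T)) :
  e \in edges u vs s -> (e.2.1 \in u :: vs) && (e.2.2 \in u :: vs).
Proof.
elim: s u vs => [|a s IHs] u [|v vs] //=.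
rewrite inE => /predU1P[->|/IHs/andP[h1 h2]].
  by rewrite /dart /=; case: a.2; rewrite /= !inE !eqxx ?orbT.
have sub : {subset v :: vs <= u :: v :: vs} by move=> z zin; rewrite in_cons zin orbT.
by apply/andP; split; apply: sub.
Qed.

Lemma relabel_inj_in (T T' : eqType) (f : T -> T') (u : T) vs s :
  {in u :: vs &, injective f} -> {in edges u vs s &, injective (relabel f)}.
Proof.
move=> finj [x [a b]] [y [c d]] /edges_in/andP[/= ha hb] /edges_in/andP[/= hc hd].
by case=> -> /finj -> // /finj ->.
Qed.

Lemma crossing_map (T T' : eqType) (f : T -> T') (u : T) vs s e :
  {in u :: vs &, injective f} -> e \in edges u vs s ->
  crossing (f u) (map f vs) s (relabel f e) = crossing u vs s e.
Proof.
move=> finj eE; rewrite /crossing darts_map big_map /=.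
rewrite big_seq_cond [RHS]big_seq_cond; apply: eq_bigl => d.
case: (boolP (d \in _)) => //= dD; apply/eqP/eqP => [|-> //].
by apply: (relabel_inj_in finj) eE; exact: (map_f fst).
Qed.

Lemma balanced_map (T T' : eqType) (f : T -> T') m (u : T) vs s :
  {in u :: vs &, injective f} ->
  balanced m (f u) (map f vs) s = balanced m u vs s.
Proof.
move=> finj; rewrite /balanced edges_map all_map; apply: eq_in_all => e eE /=.
by rewrite crossing_map.
Qed.

Lemma edges_cons (T : Type) (u v : T) vs a s :
  edges u (v :: vs) (a :: s) = (dart u v a).1 :: edges v vs s.
Proof. by []. Qed.

Lemma edges_cat (T : Type) (u : T) s1 s2 vs1 vs2 : size vs1 = size s1 ->
  edges u (vs1 ++ vs2) (s1 ++ s2) = edges u vs1 s1 ++ edges (last u vs1) vs2 s2.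
Proof.
elim: s1 u vs1 => [|a s1 IHs] u [|v vs1] //= [sz].
by rewrite !edges_cons IHs.
Qed.

End Walks.

Arguments edges : simpl never.

(** The folding condition of Stallings: the edges with a given label form a partial
injection. It is what makes them extend to permutations of the vertices. *)
Definition folded (X T : eqType) (E : seq (X * (T * T))) :=
  all (fun e => all (fun e' => (e.1 == e'.1) ==>
    ((e.2.1 == e'.2.1) == (e.2.2 == e'.2.2))) E) E.

Lemma foldedP (X T : eqType) (E : seq (X * (T * T))) :
  reflect (forall e e', e \in E -> e' \in E -> e.1 = e'.1 -> (e.2.1 == e'.2.1) = (e.2.2 == e'.2.2))
          (folded E).
Proof.
apply: (iffP allP) => [H e e' eE e'E ee'|H e eE].
  have /allP/(_ e' e'E) := H e eE; by rewrite ee' eqxx => /eqP.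
by apply/allP => e' e'E; apply/implyP => /eqP ee'; rewrite (H e e').
Qed.

Lemma folded_relabel (X T T' : eqType) (f : T -> T') (u : T) vs (l : seq (X * bool)) :
  {in u :: vs &, injective f} ->
  folded (edges (f u) (map f vs) l) = folded (edges u vs l).
Proof.
move=> finj; have feq : {in u :: vs &, forall a b, (f a == f b) = (a == b)}.
  by move=> a b ain bin; apply/eqP/eqP => [/finj->|->].
rewrite edges_map /folded all_map; apply: eq_in_all => e eE /=.
rewrite all_map; apply: eq_in_all => e' e'E /=.
have /andP[e1 e2] := edges_in eE; have /andP[e1' e2'] := edges_in e'E.
by rewrite !feq.
Qed.

Section ReversibleWalks.
Variables (X : choiceType) (T : eqType) (st : T -> X * bool -> T).
Hypothesis stK : reversible st.

Lemma walk_edge u l e :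
  e \in edges u (scanl st u l) l -> st e.2.1 (e.1, false) = e.2.2.
Proof.
elim: l u => //= a l IHl u; rewrite edges_cons inE => /predU1P[->|/IHl//].
by rewrite /dart /=; case: a => x [] //=; exact: stK.
Qed.

(** A step that can be undone is injective. *)
Lemma folded_walk u l : folded (edges u (scanl st u l) l).
Proof.
apply/foldedP => e e' /walk_edge <- /walk_edge <- ->.
apply/eqP/eqP => [-> //|/(congr1 (fun z => st z (e'.1, true)))].
by have sK z : st (st z (e'.1, false)) (e'.1, true) = z := stK z _; rewrite !sK.
Qed.

End ReversibleWalks.

(** * Spanning trees and the cyclomatic number *)

Section Graphs.
Local Open Scope group_scope.
Variables (X : choiceType) (T : eqType).
Implicit Types (a : X * bool) (s l : seq (X * bool)) (u v : T) (V vs : seq T).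
Implicit Types (E : seq (X * (T * T))).
Local Notation F := (free_group X).

Definition incident V E := forall e, e \in E -> (e.2.1 \in V) && (e.2.2 \in V).

Lemma incident_rcons V E u a v : incident V E -> u \in V ->
  incident (rcons V v) (rcons E (dart u v a).1).
Proof.
move=> inc uV e; rewrite mem_rcons inE !mem_rcons !in_cons => /predU1P[->|/inc/andP[-> ->]].
  by rewrite /dart /=; case: a.2; rewrite /= uV eqxx !orbT.
by rewrite !orbT.
Qed.

Arguments incident_rcons {V E u} a v _ _ _ _.

Lemma incident_edges u vs l : incident (u :: vs) (edges u vs l).
Proof. by move=> e; exact: edges_in. Qed.

(** The element [t v] is read along the path of the tree from the root to v. The last
clause replaces the path by its effect: if y maps the vertices to the states of a
reversible system compatibly with the edges of the tree, then the run of [t v]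
follows the image of this path, from [y root] to [y v]. *)
Definition spanning_tree (root : T) V E (t : T -> F) (TE : seq (X * (T * T))) :=
  [/\ [/\ uniq TE, {subset TE <= E} & root \in V], (size TE).+1 = distinct V, t root = 1,
      forall e, e \in TE -> t e.2.1 * gen e.1 = t e.2.2 &
      forall (Y : Type) (st : Y -> X * bool -> Y) (y : T -> Y), reversible st ->
        (forall e, e \in TE -> st (y e.2.1) (e.1, false) = y e.2.2) ->
        forall v, v \in V -> foldl st (y root) (word (t v)) = y v].

(** The tree is built along the walk: a step to a new vertex adds its edge to the
tree, any other step leaves the tree as it is. *)
Lemma spanning_tree_step root V E u a v : incident V E -> u \in V ->
  (exists t TE, spanning_tree root V E t TE) ->
  exists t TE, spanning_tree root (rcons V v) (rcons E (dart u v a).1) t TE.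
Proof.
move=> inc uV [t [TE [[uTE sTE rV] szTE t1 tE tY]]].
have sub e : e \in TE -> e \in rcons E (dart u v a).1.
  by move=> /sTE eE; rewrite mem_rcons inE eE orbT.
have [vV|vV] := boolP (v \in V).
  exists t, TE; split=> //; first by split; rewrite // mem_rcons inE rV orbT.
    by rewrite distinct_rcons vV.
  move=> Y st y stK yE v'; rewrite mem_rcons inE => /predU1P[->|]; exact: tY.
have uv : (u == v) = false by apply: contraNF vV => /eqP <-.
pose t' v' := if v' == v then t u * letter (@gen X) a else t v'.
have t'V v' : v' \in V -> t' v' = t v'.
  by rewrite /t'; case: eqP => // ->; rewrite (negbTE vV).
have t'v : t' v = t u * letter (@gen X) a by rewrite /t' eqxx.
have eTE : (dart u v a).1 \notin TE.
  apply: contra vV => /sTE/inc; rewrite /dart /=; case: a.2 => /= /andP[] //.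
exists t', ((dart u v a).1 :: TE); split.
- split; first by rewrite /= eTE.
    by move=> e; rewrite inE mem_rcons inE => /predU1P[->|/sTE ->]; rewrite ?eqxx ?orbT.
  by rewrite mem_rcons inE rV orbT.
- by rewrite distinct_rcons vV /= szTE.
- by rewrite t'V.
- move=> e; rewrite inE => /predU1P[->|eT]; last first.
    by have /andP[e1 e2] := inc e (sTE e eT); rewrite !t'V // tE.
  rewrite /dart /letter /= in t'v *; case: a.2 t'v => /= t'v; rewrite t'v t'V //.
  by rewrite mulgVK.
move=> Y st y stK yE.
have yT v' : v' \in V -> foldl st (y root) (word (t v')) = y v'.
  by apply: tY => // e eT; apply: yE; rewrite inE eT orbT.
move=> v'; rewrite mem_rcons inE => /predU1P[->|v'V]; last by rewrite t'V // yT.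
rewrite t'v (foldl_wordM stK) yT // word_letter /=.
have := yE _ (mem_head _ _); rewrite /dart /=; case: (a) => x [] /= <- //.
Qed.

Lemma spanning_tree_walk root V E u vs l : incident V E -> u \in V -> size vs = size l ->
  (exists t TE, spanning_tree root V E t TE) ->
  exists t TE, spanning_tree root (V ++ vs) (E ++ edges u vs l) t TE.
Proof.
elim: l u vs V E => [|a l IHl] u [|v vs] V E inc uV //= sz tr; first by rewrite !cats0.
rewrite edges_cons -!cat_rcons; apply: IHl; last exact: spanning_tree_step.
- exact: incident_rcons.
- by rewrite mem_rcons mem_head.
- by case: sz.
Qed.

Lemma spanning_tree_exists root vs l : size vs = size l ->
  exists t TE, spanning_tree root (root :: vs) (edges root vs l) t TE.
Proof.
move=> sz; apply: (@spanning_tree_walk root [:: root] [::]) => //.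
- exact: mem_head.
- exists (fun=> 1), [::]; split => //; first by split; rewrite ?mem_head.
  by move=> Y st y _ _ v; rewrite inE => /eqP ->.
Qed.

(** A new vertex is reached through a new edge, so that the difference between the
numbers of edges and vertices never decreases along a walk. *)
Lemma euler_step V E u a v : incident V E -> u \in V ->
  (distinct (rcons V v) + distinct E <=
   distinct (rcons E (dart u v a).1) + distinct V)%N.
Proof.
move=> inc uV; rewrite !distinct_rcons.
case: (boolP (v \in V)) => vV /=; first lia.
have -> : (dart u v a).1 \notin E.
  by apply: contra vV => /inc; rewrite /dart /=; case: a.2 => /= /andP[].
by rewrite /=; lia.
Qed.

Arguments euler_step {V E u} a v _ _.

Lemma euler_walk V E u vs l : incident V E -> u \in V -> size vs = size l ->
  (distinct (V ++ vs) + distinct E <=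
   distinct (E ++ edges u vs l) + distinct V)%N.
Proof.
elim: l u vs V E => [|a l IHl] u [|v vs] V E inc uV //= sz; first by rewrite !cats0 addnC.
rewrite edges_cons -!cat_rcons; have := euler_step a v inc uV.
have := IHl v vs (rcons V v) (rcons E (dart u v a).1).
rewrite mem_rcons mem_head => /(_ (incident_rcons a v inc uV) isT) H.
by have := H ltac:(by case: sz); lia.
Qed.

(** The walk that continues by l does not raise the cyclomatic number. By
[tight_cons] none of its steps does: each new edge leads to a new vertex. *)
Definition tight V E u vs l :=
  (distinct (E ++ edges u vs l) + distinct V <=
   distinct (V ++ vs) + distinct E)%N.

Lemma tight_cons V E u a v vs l : incident V E -> u \in V -> size vs = size l ->
  tight V E u (v :: vs) (a :: l) ->
  ((dart u v a).1 \notin E -> v \notin V) /\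
  tight (rcons V v) (rcons E (dart u v a).1) v vs l.
Proof.
rewrite /tight edges_cons -!cat_rcons => inc uV sz tot.
have inc' := incident_rcons a v inc uV.
have vV' : v \in rcons V v by rewrite mem_rcons mem_head.
have := euler_walk inc' vV' sz; have := euler_step a v inc uV.
move: tot; rewrite !distinct_rcons.
by case: (_ \in E); case: (v \in V) => /=; split=> //; lia.
Qed.

Lemma reduced_cons a l : reduced (a :: l) -> reduced l.
Proof. exact: path_sorted. Qed.

(** A reduced walk that enters a leaf cannot go back, since the only known edge at the
leaf would undo the last letter a. Its next edge is therefore new, leads to a new
vertex by tightness, and this vertex is again a leaf. *)
Lemma tight_leaf (W : {pred T}) V E p a u vs l : incident V E -> u \in V ->
  size vs = size l -> p != u -> {subset W <= V} -> u \notin W ->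
  (forall e, e \in E -> (e.2.1 == u) || (e.2.2 == u) -> e = (dart p u a).1) ->
  reduced (a :: l) -> tight V E u vs l -> last u vs \notin W.
Proof.
elim: l a p u vs V E => [|b l IHl] a p u [|v vs] V E inc uV //= [sz] pu sWV uW leaf red tig.
have [new tig'] := tight_cons inc uV sz tig.
have eE : (dart u v b).1 \notin E.
  apply/negP => eE; have := leaf _ eE.
  move: red => /= /andP[ba _] {leaf new tig tig'}.
  have up : (u == p) = false by rewrite eq_sym (negbTE pu).
  move: ba; rewrite /dart /flip; case: a b {eE} => x [] [y []] /=;
    rewrite eqxx ?orbT => ba /(_ isT) [] xy.
  - by move=> _ /eqP; rewrite up.
  - by case/eqP: ba; rewrite xy.
  - by case/eqP: ba; rewrite xy.
  by move=> /eqP; rewrite up.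
have vV := new eE.
apply: (IHl b u v vs _ _ (incident_rcons b v inc uV)) => //.
- by rewrite mem_rcons mem_head.
- by apply: contraNneq vV => <-.
- by move=> z /sWV zV; rewrite mem_rcons inE zV orbT.
- by apply: contra vV => /sWV.
- move=> e; rewrite mem_rcons inE => /predU1P[-> //|/inc/andP[e1 e2]].
  by case/orP => /eqP ev; move: e1 e2 vV; rewrite ev => e1 e2; rewrite ?e1 ?e2.
by case/andP: red.
Qed.

(** At its first new edge the walk would enter a leaf and then never return to V. *)
Lemma tight_reduced_loop V E u vs l : incident V E -> u \in V -> size vs = size l ->
  reduced l -> tight V E u vs l -> last u vs \in V -> {subset edges u vs l <= E}.
Proof.
elim: l u vs V E => [|a l IHl] u [|v vs] V E inc uV //= [sz] red tig lV.
have [new tig'] := tight_cons inc uV sz tig.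
have inc' := incident_rcons a v inc uV.
have [eE|eE] := boolP ((dart u v a).1 \in E).
  move=> e; rewrite edges_cons inE => /predU1P[->//|].
  move=> /(IHl v vs _ _ inc' _ sz (reduced_cons red) tig').
  rewrite !mem_rcons !inE eqxx lV orbT => /(_ isT isT) /predU1P[->//|//].
have vV := new eE; suff : last v vs \notin V by rewrite lV.
apply: (@tight_leaf (mem V) _ _ u a v vs l inc' _ sz) => //.
- by rewrite mem_rcons mem_head.
- by apply: contraNneq vV => <-.
- by move=> z zV; rewrite mem_rcons inE zV orbT.
move=> e; rewrite mem_rcons inE => /predU1P[-> //|/inc/andP[e1 e2]].
by case/orP => /eqP ev; move: e1 e2 vV; rewrite ev => e1 e2; rewrite ?e1 ?e2.
Qed.

End Graphs.

(** * The subgroup spanned by a walk *)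

Section Holonomy.
Variables (X : choiceType) (T : eqType) (st : T -> X * bool -> T).
Hypothesis stK : reversible st.
Variables (Y : Type) (mu mu' : X * (T * T) -> Y -> Y).
Hypotheses (muK : forall e, cancel (mu e) (mu' e)) (muVK : forall e, cancel (mu' e) (mu e)).

(** The lift of a system of steps to the trivial bundle with fibre Y, where crossing
the edge e acts on the fibre by [mu e]. *)
Definition holonomy (c : T * Y) (a : X * bool) : T * Y :=
  let e := (dart c.1 (st c.1 a) a).1 in
  (st c.1 a, if a.2 then mu' e c.2 else mu e c.2).

Lemma holonomy_reversible : reversible holonomy.
Proof.
move=> [c y] a; rewrite /holonomy /= stK /dart /flip /=; congr pair.
by case: a => x [] /=; rewrite ?muK ?muVK.
Qed.

Lemma holonomy_edge e y : st e.2.1 (e.1, false) = e.2.2 ->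
  holonomy (e.2.1, y) (e.1, false) = (e.2.2, mu e y).
Proof. by case: e => x [u v] /= <-. Qed.

Lemma foldl_holonomy1 c s : (foldl holonomy c s).1 = foldl st c.1 s.
Proof. by elim: s c => //= a s IHs c; rewrite IHs. Qed.

End Holonomy.

Section Cosets.
Local Open Scope classical_set_scope.
Local Open Scope group_scope.
Variable X : choiceType.
Local Notation F := (free_group X).
Local Notation gword := (wordprod (@gen X)).
Implicit Types (H c : set F).

(** Right multiplication of the right coset c by the letter a; starting at a subgroup
H, the run of g ends at the coset H g. *)
Definition coset_step c (a : X * bool) : set F := [set x | c (x * (letter (@gen X) a)^-1)].

Lemma coset_reversible : reversible coset_step.
Proof.
move=> c a; apply/seteqP.
by split => x; rewrite /coset_step /= letter_flip invgK mulgK.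
Qed.

Lemma foldl_coset c l : foldl coset_step c l = [set x | c (x * (gword l)^-1)].
Proof.
elim: l c => [|a l IHl] c /=.
  by apply/seteqP; split => x; rewrite /= /wordprod big_nil invg1 mulg1.
rewrite IHl; apply/seteqP.
by split => x; rewrite /coset_step /= wordprod_cons invgM mulgA.
Qed.

Lemma coset_eq H l l' : is_subgroup H ->
  foldl coset_step H l = foldl coset_step H l' <-> H (gword l * (gword l')^-1).
Proof.
move=> sH; have [H1 HM HV] := sH; rewrite !foldl_coset; split=> [e|Hll].
  have : [set x | H (x * (gword l)^-1)] (gword l) by rewrite /= mulgV.
  by rewrite e.
apply/seteqP; split => x /= Hx.
  by rewrite -(mulgVK (gword l) x) -mulgA; apply: HM.
rewrite -(mulgVK (gword l') x) -mulgA; apply: HM => //.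
by have := HV _ Hll; rewrite invgM invgK.
Qed.

Lemma coset_loop H l : is_subgroup H -> foldl coset_step H l = H <-> H (gword l).
Proof.
move=> sH; have := @coset_eq H l [::] sH; rewrite /= => ->.
by rewrite {2}/wordprod big_nil invg1 mulg1.
Qed.

End Cosets.

Section WalkGroup.
Local Open Scope classical_set_scope.
Local Open Scope group_scope.
Variable X : choiceType.
Local Notation F := (free_group X).
Local Notation gword := (wordprod (@gen X)).

(** The fundamental group, at u, of the graph traced by the walk, read in the free
group. This set of generators shows that it depends only on which positions of the
walk are at the same vertex. *)
Definition walk_group (T : eqType) (u : T) (vs : seq T) (s : seq (X * bool)) : set F :=
  generated [set g | exists i j, [/\ (i <= size s)%N, (j <= size s)%N,
    nth u (u :: vs) i = nth u (u :: vs) j & g = gword (take i s) * (gword (take j s))^-1]].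

Lemma walk_group_subgroup (T : eqType) (u : T) vs s : is_subgroup (walk_group u vs s).
Proof. exact: generated_subgroup. Qed.

Variables (T : choiceType) (st : T -> X * bool -> T).
Hypothesis stK : reversible st.
Variables (root : T) (s : seq (X * bool)).
Let vs := scanl st root s.
Let V := root :: vs.
Let E := edges root vs s.

Lemma walk_edge_step (u : T) l e : e \in edges u (scanl st u l) l ->
  exists k a, [/\ (k < size l)%N, take k.+1 l = rcons (take k l) a &
    e = (dart (foldl st u (take k l)) (foldl st u (take k.+1 l)) a).1].
Proof.
elim: l u => //= a l IHl u; rewrite edges_cons inE => /predU1P[->|/IHl[k [b [lt_k tk ->]]]].
  by exists 0%N, a; rewrite /= take0.
by exists k.+1, b; split=> //=; rewrite tk.
Qed.

Lemma nth_walk (u : T) l i : (i <= size l)%N ->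
  nth root (u :: scanl st u l) i = foldl st u (take i l).
Proof. by elim: l u i => [|a l IHl] u [|i] //= le_i; rewrite -IHl. Qed.

Variables (t : T -> F) (TE : seq (X * (T * T))).
Hypothesis tree : spanning_tree root V E t TE.

Definition closing_edges := [seq e <- undup E | e \notin TE].
Let n := size closing_edges.
Let closing (i : 'I_n) := tnth (in_tuple closing_edges) i.

(** From the root to the edge along the tree, through the edge, and back. *)
Definition edge_loop (e : X * (T * T)) : F := t e.2.1 * gen e.1 * (t e.2.2)^-1.
Definition basis_loop (i : 'I_n) : F := edge_loop (closing i).

(** The tree has one edge less than there are vertices. *)
Lemma size_closing_edges : (n + distinct V = distinct E + 1)%N.
Proof.
case: tree => [[uTE sTE _] szTE _ _ _].
have perm_TE : perm_eq [seq e <- undup E | e \in TE] TE.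
  apply: uniq_perm; rewrite ?filter_uniq ?undup_uniq // => e.
  by rewrite mem_filter mem_undup /= andbC; case: (boolP (e \in TE)) => [/sTE ->|_]; rewrite ?andbF.
rewrite -szTE /distinct -(count_predC [in TE] (undup E)) -!size_filter.
rewrite (perm_size perm_TE) addnS addn1 addnC; congr (_ + _).+1.
Qed.

Lemma closingP i : closing i \in E /\ closing i \notin TE.
Proof.
have : closing i \in closing_edges by exact: mem_tnth.
by rewrite mem_filter mem_undup => /andP[].
Qed.

Lemma closing_inj : injective closing.
Proof.
apply/tuple_uniqP => /=; rewrite filter_uniq ?undup_uniq //.
Qed.

Section Labels.
Variables (Y : Type) (mu mu' : X * (T * T) -> Y -> Y).
Hypotheses (muK : forall e, cancel (mu e) (mu' e)) (muVK : forall e, cancel (mu' e) (mu e)).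
Hypothesis mu_tree : forall e y, e \in TE -> mu e y = y.
Local Notation hol := (holonomy st mu mu').

Lemma holonomy_tree y v : v \in V -> foldl hol (root, y) (word (t v)) = (v, y).
Proof.
case: tree => [[_ sTE _] _ _ _ tY] vV.
apply: (tY _ hol (fun v => (v, y))) => //; first exact: holonomy_reversible.
move=> e eT; rewrite holonomy_edge ?mu_tree //; apply: (walk_edge stK); exact: sTE eT.
Qed.

(** The fibre does not move along the tree, so that only the crossing of e counts. *)
Lemma holonomy_edge_loop e y : e \in E -> foldl hol (root, y) (word (edge_loop e)) = (root, mu e y).
Proof.
move=> eE; have /andP[e1 e2] := edges_in eE.
have hK := @holonomy_reversible _ _ _ stK _ _ _ muK muVK.
rewrite /edge_loop !(foldl_wordM hK) holonomy_tree // foldl_word_gen.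
rewrite holonomy_edge; last exact: (walk_edge stK eE).
by rewrite -(holonomy_tree (mu e y) e2) (foldl_wordV hK).
Qed.

End Labels.

Definition edge_label (e : X * (T * T)) : free_group 'I_n :=
  if [pick i | closing i == e] is Some i then gen i else 1.

Lemma edge_label_closing i : edge_label (closing i) = gen i.
Proof.
rewrite /edge_label; case: pickP => [j /eqP/closing_inj -> //|/(_ i)].
by rewrite eqxx.
Qed.

Lemma edge_label_tree e : e \in TE -> edge_label e = 1.
Proof.
rewrite /edge_label; case: pickP => // i /eqP <- iT.
by have [_] := closingP i; rewrite iT.
Qed.

Lemma extend_edge_label e : e \in E -> extend basis_loop (edge_label e) = edge_loop e.
Proof.
case: tree => [[_ sTE _] _ _ tE _] eE.
have [eT|eT] := boolP (e \in TE).
  by rewrite edge_label_tree // extend1 /edge_loop tE // mulgV.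
have : e \in closing_edges by rewrite mem_filter eT mem_undup.
move=> /(tnthP (in_tuple _))[i ->].
by rewrite edge_label_closing extend_gen.
Qed.

(** Let the fibre be the free group on the closing edges, and let each closing edge act
by right multiplication by its generator. The run of [extend basis_loop u] then moves
the fibre by u, which is thus recovered from its image. *)
Lemma basis_loop_inj : injective (extend basis_loop).
Proof.
pose mu e (z : free_group 'I_n) := z * edge_label e.
pose mu' e (z : free_group 'I_n) := z * (edge_label e)^-1.
have muK e : cancel (mu e) (mu' e) by move=> z; rewrite /mu /mu' mulgK.
have muVK e : cancel (mu' e) (mu e) by move=> z; rewrite /mu /mu' mulgVK.
have mu_tree e y : e \in TE -> mu e y = y by move=> /edge_label_tree eT; rewrite /mu eT mulg1.
have hK := @holonomy_reversible _ _ _ stK _ _ _ muK muVK.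
have hol u z : foldl (holonomy st mu mu') (root, z) (word (extend basis_loop u)) = (root, z * u).
  elim/free_group_ind: u z => [|a u IHu] z; first by rewrite extend1 mulg1.
  rewrite extendM (foldl_wordM hK) extend_letter.
  have loop i y : foldl (holonomy st mu mu') (root, y) (word (basis_loop i)) = (root, y * gen i).
    rewrite (holonomy_edge_loop muK muVK mu_tree) /mu ?edge_label_closing //.
    by case: (closingP i).
  have -> : foldl (holonomy st mu mu') (root, z) (word (letter basis_loop a)) =
     (root, z * letter (@gen _) a).
    rewrite /letter; case: a.2 => //.
    rewrite -[X in foldl _ (_, X)](mulgVK (gen a.1) z) -loop.
    by rewrite (foldl_wordV hK).
  by rewrite IHu mulgA.
by move=> u v uv; have := hol u 1; rewrite uv hol !mul1g => -[].
Qed.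

Definition label_word (D : seq ((X * (T * T)) * bool)) : free_group 'I_n :=
  wordprod edge_label D.

(** The factors of the tree telescope along the walk. *)
Lemma extend_label_word u l : {subset edges u (scanl st u l) l <= E} ->
  t u * gword l = extend basis_loop (label_word (darts u (scanl st u l) l)) * t (foldl st u l).
Proof.
elim: l u => [|a l IHl] u sub /=.
  by rewrite /label_word /wordprod !big_nil extend1 mulg1 mul1g.
rewrite /label_word !wordprod_cons extendM -mulgA -IHl; last first.
  by move=> e eE; apply: sub; rewrite edges_cons inE eE orbT.
have eE : (dart u (st u a) a).1 \in E by apply: sub; rewrite edges_cons mem_head.
rewrite !mulgA; congr (_ * _); have := extend_edge_label eE.
rewrite /letter /edge_loop /dart; case: a.2 => /= eL.
  by rewrite extendV eL !invgM invgK !mulgA mulgVK.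
by rewrite eL mulgVK.
Qed.

Lemma loop_in_basis l : {subset edges root (scanl st root l) l <= E} ->
  foldl st root l = root -> range (extend basis_loop) (gword l).
Proof.
move=> sub loop; have := extend_label_word sub.
case: tree => _ _ t1 _ _; rewrite loop t1 mul1g mulg1 => ->.
by exists (label_word (darts root (scanl st root l) l)).
Qed.

Lemma subset_take i : {subset edges root (scanl st root (take i s)) (take i s) <= E}.
Proof.
rewrite /E /vs; elim: s root i => [|a l IHl] u [|i] e //.
by rewrite /= !edges_cons !inE => /predU1P[->|/IHl ->]; rewrite ?eqxx ?orbT.
Qed.

(** One inclusion is the telescoping of [extend_label_word]. For the other, send the
vertex v to the coset y(v) of a prefix that ends at v, for the subgroup H on the
right-hand side. The edges of the walk respect y, hence so does the path of the tree
to v: the coset of [t v] is y(v). The loop of an edge then fixes the coset H. *)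
Lemma range_basis_loop : range (extend basis_loop) = walk_group root vs s.
Proof.
case: (tree) => _ _ t1 tE tY; apply/seteqP; split; last first.
  move=> g; apply; first exact: range_extend_subgroup.
  move=> _ [i [j [le_i le_j eq_ij ->]]].
  have pref k : (k <= size s)%N -> gword (take k s) =
      extend basis_loop (label_word (darts root (scanl st root (take k s)) (take k s))) *
      t (nth root V k).
    move=> le_k; rewrite nth_walk // -extend_label_word; last exact: subset_take.
    by rewrite t1 mul1g.
  rewrite (pref i) // (pref j) // eq_ij invgM mulgA mulgK.
  by apply: subgroupVM; [exact: range_extend_subgroup|eexists|eexists].
set H := walk_group root vs s.
have sH : is_subgroup H := walk_group_subgroup root vs s.
apply: subgroup_extend => // i.
pose y v := foldl (@coset_step X) H (take (index v V) s).
have yV k : (k <= size s)%N -> y (nth root V k) = foldl (@coset_step X) H (take k s).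
  move=> le_k; apply/coset_eq => //; apply: sub_generated.
  have kV : (k < size V)%N by rewrite /= size_scanl.
  have in_V : nth root V k \in V by exact: mem_nth.
  exists (index (nth root V k) V), k; split=> //; last by rewrite nth_index.
  by have := index_mem (nth root V k) V; rewrite in_V /= size_scanl ltnS.
have yE e : e \in E -> coset_step (y e.2.1) (e.1, false) = y e.2.2.
  move=> /walk_edge_step[k [a [lt_k tk ->]]].
  set u := foldl st root (take k s); set v := foldl st root (take k.+1 s).
  have yv : y v = coset_step (y u) a.
    have := yV k (ltnW lt_k); have := yV k.+1 lt_k.
    rewrite (@nth_walk root s k.+1 lt_k) (@nth_walk root s k (ltnW lt_k)) => -> ->.
    by rewrite tk foldl_rcons.
  rewrite /dart /=; case: (a) yv => x [] /= -> //.
  by have := coset_reversible (y u) (x, true).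
have yt v : v \in V -> foldl (@coset_step X) H (word (t v)) = y v.
  have -> : H = y root by rewrite /y /= eqxx take0.
  apply: tY; first exact: coset_reversible.
  by case: (tree) => [[_ sTE _] _ _ _ _] e /sTE; exact: yE.
have [iE _] := closingP i; have /andP[i1 i2] := edges_in iE.
rewrite /basis_loop /edge_loop -[t _ * gen _]wordprod_word -[t (closing i).2.2]wordprod_word.
apply/coset_eq => //; rewrite (foldl_wordM (@coset_reversible X)) foldl_word_gen.
by rewrite !yt // yE.
Qed.

Lemma gword_label_word : foldl st root s = root ->
  gword s = extend basis_loop (label_word (darts root vs s)).
Proof.
move=> loop; have := @extend_label_word root s (fun e eE => eE).
by case: tree => _ _ t1 _ _; rewrite loop t1 mul1g mulg1.
Qed.

Lemma expsum_label_word i (D : seq ((X * (T * T)) * bool)) :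
  expsum i (label_word D) = (\sum_(d <- D | d.1 == closing i) (-1) ^+ d.2)%R.
Proof.
elim: D => [|d D IHD]; first by rewrite /label_word /wordprod !big_nil expsum1.
rewrite /label_word wordprod_cons expsumM big_cons -[wordprod _ _]/(label_word D) IHD.
have labE : expsum i (edge_label d.1) = (d.1 == closing i)%:R%R.
  rewrite /edge_label; case: pickP => [j /eqP <-|no_i].
    by rewrite expsum_gen (inj_eq closing_inj).
  by rewrite expsum1 eq_sym no_i.
by rewrite /letter; case: d.2; rewrite ?expsumV labE; case: eqP => _; rewrite ?add0r ?oppr0 ?add0r.
Qed.

(** The exponents of the word s in the basis of closing edges are their crossing
numbers. *)
Lemma Kker_walk_group m : foldl st root s = root -> balanced m root vs s ->
  Kker m (walk_group root vs s) (gword s).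
Proof.
move=> loop /balancedP bal.
have expE i : expsum i (label_word (darts root vs s)) = crossing root vs s (closing i).
  exact: expsum_label_word.
rewrite gword_label_word // -range_basis_loop; case: m bal => [k|] /= bal.
  exists 'I_n, basis_loop; split; first by split=> //; exact: basis_loop_inj.
  by exists (label_word (darts root vs s)); split=> // i; rewrite expE; exact: bal.
apply: derived_expsum0 => [|i|i].
- exact: range_extend_subgroup.
- by exists (gen i); rewrite // extend_gen.
by rewrite expE; apply/eqP; exact: bal.
Qed.

Lemma walk_group_is_basis : is_basis basis_loop (walk_group root vs s).
Proof. by split; [exact: basis_loop_inj|exact: range_basis_loop]. Qed.

(** The elements of the walk group fix the root, since its generators do. *)
Lemma walk_group_kernel i j : (i <= size s)%N -> (j <= size s)%N ->
  walk_group root vs s (gword (take i s) * (gword (take j s))^-1) <->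
  nth root V i = nth root V j.
Proof.
move=> le_i le_j; split=> [Hij|eq_ij]; last by apply: sub_generated; exists i, j.
have wE k : (k <= size s)%N -> nth root V k = foldl st root (word (gword (take k s))).
  by move=> le_k; rewrite (foldl_wordprod _ _ stK) -nth_walk.
have fixed g : walk_group root vs s g -> foldl st root (word g) = root.
  move=> /(_ [set g | foldl st root (word g) = root]); apply.
    split=> [//|g1 g2|g1]; rewrite /mkset => r1; first by rewrite (foldl_wordM stK) r1.
    by rewrite -[X in foldl _ X]r1 (foldl_wordV stK).
  move=> _ [k [l [le_k le_l eq_kl ->]]]; rewrite /mkset.
  by rewrite (foldl_wordM stK) -wE // [nth _ _ _]eq_kl wE // (foldl_wordV stK).
have := fixed _ Hij; rewrite (foldl_wordM stK) -wE //.
move=> /(congr1 (fun z => foldl st z (word (gword (take j s))))).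
by rewrite (foldl_wordVV stK) -wE.
Qed.

End WalkGroup.

(** * Walks in the coset graph of a subgroup *)

Section AdditiveHolonomy.
Local Open Scope ring_scope.
Variables (X : choiceType) (T : choiceType) (st : T -> X * bool -> T).
Hypothesis stK : reversible st.
Variables (Y : zmodType) (f : X * (T * T) -> Y).

Definition add_label e (y : Y) := y + f e.
Definition sub_label e (y : Y) := y - f e.
Definition add_holonomy := holonomy st add_label sub_label.

Lemma add_labelK e : cancel (add_label e) (sub_label e).
Proof. by move=> y; rewrite /add_label /sub_label addrK. Qed.

Lemma sub_labelK e : cancel (sub_label e) (add_label e).
Proof. by move=> y; rewrite /add_label /sub_label subrK. Qed.

Lemma add_holonomy_reversible : reversible add_holonomy.
Proof. exact: holonomy_reversible add_labelK sub_labelK. Qed.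

Lemma foldl_add_holonomy c y l : foldl add_holonomy (c, y) l =
  (foldl st c l, y + \sum_(d <- darts c (scanl st c l) l) (if d.2 then - f d.1 else f d.1)).
Proof.
elim: l c y => [|a l IHl] c y /=; first by rewrite big_nil addr0.
rewrite IHl big_cons addrA; congr (_, _ + _).
by rewrite /add_label /sub_label /dart /=; case: a.2.
Qed.

End AdditiveHolonomy.

Section SubgroupCosets.
Local Open Scope classical_set_scope.
Local Open Scope group_scope.
Variable X : choiceType.
Local Notation F := (free_group X).
Local Notation gword := (wordprod (@gen X)).
Variable H : set F.
Hypothesis sH : is_subgroup H.
Local Notation cstep := (@coset_step X).

Lemma foldl_coset_mem g : H g -> foldl cstep H (word g) = H.
Proof. by move=> Hg; apply/coset_loop; rewrite ?wordprod_word. Qed.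

Section Character.
Local Open Scope ring_scope.
Variables (Y : zmodType) (f : X * (set F * set F) -> Y).

(** The sum of the labels along the run of g in the coset graph; on the subgroup H it
is a homomorphism. *)
Definition character (g : F) : Y := (foldl (add_holonomy cstep f) (H, 0) (word g)).2.

Lemma add_holonomy_mem g y : H g ->
  foldl (add_holonomy cstep f) (H, y) (word g) = (H, y + character g).
Proof.
move=> Hg; rewrite /character !foldl_add_holonomy /= add0r.
by rewrite foldl_coset_mem.
Qed.

Lemma characterM g h : H g -> H h -> character (g * h)%g = character g + character h.
Proof.
move=> Hg Hh; have [_ HM _] := sH; have hK := add_holonomy_reversible (@coset_reversible X) f.
rewrite {1}/character (foldl_wordM hK) (add_holonomy_mem _ Hg).
by rewrite (add_holonomy_mem _ Hh) add0r.
Qed.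

Lemma characterV g : H g -> character g^-1%g = - character g.
Proof.
move=> Hg; have [_ _ HV] := sH; apply/eqP; rewrite -addr_eq0 -characterM //; last exact: HV.
by rewrite mulVg.
Qed.

Lemma character_extend (I : choiceType) (b : I -> F) (u : free_group I) : (forall i, H (b i)) ->
  character (extend b u) =
  \sum_(a <- word u) (if a.2 then - character (b a.1) else character (b a.1)).
Proof.
move=> Hb; rewrite extendE; have [H1 HM HV] := sH.
have Hl a : H (letter b a) by rewrite /letter; case: a.2; [apply: HV|].
have Hw s : H (wordprod b s).
  by elim: s => [|a s IHs]; [rewrite /wordprod big_nil|rewrite wordprod_cons; apply: HM].
elim: (word u) => [|a s IHs]; first by rewrite /wordprod !big_nil.
rewrite wordprod_cons characterM // IHs big_cons; congr (_ + _).
by rewrite /letter; case: a.2; rewrite ?characterV.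
Qed.

End Character.

Section Rank.
Variable s : seq (X * bool).
Let vs := scanl cstep H s.
Let V := H :: vs.
Let E := edges H vs s.

(** Labels in F_2 on the n closing edges give characters of H with independent values
on the n loops of these edges, hence 2^n distinct characters, whereas a character is
determined by its values on the n0 elements of a basis of H. *)
Lemma rank_le (n0 : nat) (b0 : 'I_n0 -> F) : is_basis b0 H ->
  (distinct E + 1 <= n0 + distinct V)%N.
Proof.
move=> [_ b0H].
have [t [TE tree]] := @spanning_tree_exists X _ H vs s (size_scanl _ _ _).
have sz := size_closing_edges tree; rewrite -sz leq_add2r.
set n := size (closing_edges cstep H s TE).
pose cl (i : 'I_n) := tnth (in_tuple (closing_edges cstep H s TE)) i.
(* These labels prescribe the values of a character on the loops of closing edges. *)
pose lab (f : {ffun 'I_n -> 'F_2}) e : 'F_2 := if [pick i | cl i == e] is Some i then f i else 0%R.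
have lab_cl f i : lab f (cl i) = f i.
  rewrite /lab; case: pickP => [j /eqP/(closing_inj (TE := TE)) -> //|/(_ i)].
  by rewrite eqxx.
have lab_tree f e : e \in TE -> lab f e = 0%R.
  rewrite /lab; case: pickP => // i /eqP <- iT.
  by have [_] := closingP i; rewrite iT.
have Hb0 j : H (b0 j) by rewrite -b0H; exists (gen j); rewrite // extend_gen.
pose restr f : {ffun 'I_n0 -> 'F_2} := [ffun j => character (lab f) (b0 j)].
have loopE f i : character (lab f) (@basis_loop X _ cstep H s t TE i) = f i.
  have muT e (y : 'F_2) : e \in TE -> add_label (lab f) e y = y.
    by move=> eT; rewrite /add_label lab_tree // addr0.
  have := holonomy_edge_loop (@coset_reversible X) tree
    (add_labelK (lab f)) (sub_labelK (lab f)) muT.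
  move=> /(_ (cl i) 0%R (closingP i).1) /(congr1 snd).
  by rewrite /add_label lab_cl add0r.
have loopH i : H (@basis_loop X _ cstep H s t TE i).
  have muK (e : X * (set F * set F)) : cancel (fun y : unit => y) (fun y => y) by [].
  have := holonomy_edge_loop (@coset_reversible X) tree muK muK (fun _ _ _ => erefl).
  move=> /(_ (cl i) tt (closingP i).1) /(congr1 fst).
  rewrite foldl_holonomy1 => /coset_loop; rewrite wordprod_word; exact.
have restr_inj : injective restr.
  move=> f f' ff'; apply/ffunP => i; rewrite -!loopE.
  have : range (extend b0) (@basis_loop X _ cstep H s t TE i) by rewrite b0H.
  case=> u _ <-; rewrite !character_extend //; apply: eq_bigr => a _.
  have -> // : character (lab f) (b0 a.1) = character (lab f') (b0 a.1).
  by have := congr1 (fun h : {ffun _ -> _} => h a.1) ff'; rewrite !ffunE.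
have := leq_card restr restr_inj; rewrite !card_ffun !card_ord.
by rewrite leq_exp2l.
Qed.

End Rank.

Section Kernel.
Variable s : seq (X * bool).
Let vs := scanl cstep H s.
Let V := H :: vs.
Let E := edges H vs s.

Lemma walk_group_sub : walk_group H vs s `<=` H.
Proof.
move=> g; apply => // _ [i [j [le_i le_j eq_ij ->]]].
by apply/coset_eq => //; rewrite -!(@nth_walk X _ cstep H).
Qed.

(** Let h be in H. Lengthening the walk by h cannot raise its cyclomatic number, which
already is the rank of H. As h is a reduced loop, it stays in the graph of the walk. *)
Lemma walk_group_full (n0 : nat) (b0 : 'I_n0 -> F) : is_basis b0 H -> H (gword s) ->
  (n0 + distinct V <= distinct E + 1)%N -> walk_group H vs s = H.
Proof.
move=> b0H Hs rk; apply/seteqP; split; first exact: walk_group_sub.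
move=> h Hh; have [t [TE tree]] := @spanning_tree_exists X _ H vs s (size_scanl _ _ _).
have loop_s : foldl cstep H s = H by apply/coset_loop.
have loop_h : foldl cstep H (word h) = H by exact: foldl_coset_mem.
rewrite -(range_basis_loop tree) -(wordprod_word h).
apply: (loop_in_basis tree _ loop_h).
have := @rank_le (s ++ word h) n0 b0 b0H; rewrite /= scanl_cat loop_s edges_cat ?size_scanl //.
rewrite last_scanl loop_s -/vs -/E -cat_cons -/V => rk'.
apply: (@tight_reduced_loop X _ V E H (scanl cstep H (word h)) (word h)).
- exact: incident_edges.
- exact: mem_head.
- by rewrite size_scanl.
- exact: word_reduced.
- have arith p q' k d : (n0 + q' <= k + 1)%N -> (p + 1 <= n0 + d)%N -> (p + q' <= d + k)%N by lia.
  exact: arith rk rk'.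
by rewrite last_scanl loop_h mem_head.
Qed.

(** Give the label 1 to the edge e and 0 to all others. The value on s of the
resulting integral character is the crossing number of e, and it is divisible by m
because s is in the kernel. *)
Lemma balanced_Kker m : Kker m H (gword s) -> balanced m H vs s.
Proof.
move=> Ks; apply/balancedP => e.
pose f (e' : X * (set F * set F)) : int := (e' == e)%:R%R.
have charE : character f (gword s) = crossing H vs s e.
  rewrite /character foldl_wordprod; last first.
    by apply: add_holonomy_reversible; exact: coset_reversible.
  rewrite foldl_add_holonomy /= add0r /crossing [RHS]big_mkcond; apply: eq_bigr => d _.
  by rewrite /f; case: eqP; case: d.2; rewrite ?oppr0.
rewrite -charE; case: m Ks => [k|] /=.
  case=> I [b [[_ bH] [u [-> ku]]]].
  have Hb i : H (b i) by rewrite -bH; exists (gen i); rewrite // extend_gen.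
  rewrite character_extend //.
  pose J := undup [seq a.1 | a <- word u].
  have -> : (\sum_(a <- word u) (if a.2 then - character f (b a.1) else character f (b a.1)) =
      \sum_(i <- J) expsum i u * character f (b i))%R.
    under [RHS]eq_bigr do rewrite /expsum big_distrl /=.
    rewrite (exchange_big_dep xpredT) //=; rewrite big_seq [RHS]big_seq; apply: eq_bigr => a au.
    rewrite [RHS]big_mkcond (bigD1_seq a.1) ?undup_uniq ?mem_undup ?map_f //= eqxx big1 ?addr0.
      by case: a.2; rewrite ?mulN1r ?mul1r.
    by move=> i /negbTE ia; rewrite eq_sym ia.
  apply: (big_ind (fun z => (k%:Z %| z)%Z)) => [|x y|i _]; first exact: dvdz0.
    exact: rpredD.
  exact: dvdz_mulr.
move=> Ds; apply/eqP; have [H1 HM HV] := sH.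
pose K := [set g : F | H g /\ character f g = 0%R].
have [] : K (gword s); last by [].
apply: Ds.
  split=> [|g h [Hg g0] [Hh h0]|g [Hg g0]]; first by [].
    by split; [exact: HM|rewrite characterM // g0 h0].
  by split; [exact: HV|rewrite characterV // g0 oppr0].
move=> _ [g Hg [h Hh <-]].
have HVg := HV _ Hg; have HVh := HV _ Hh; have Hgh := HM _ _ Hg Hh.
have Hc := HM _ _ HVh Hgh.
split; rewrite /commg /conjg; first exact: HM.
by rewrite !characterM // !characterV //; lia.
Qed.

End Kernel.

End SubgroupCosets.

(** * Asymptotics of falling factorials *)

Section Asymptotics.
Variable R : realFieldType.
Implicit Types (f g : nat -> R) (k l : int).
Local Open Scope ring_scope.

(** f(N) = N^k (1 + O(1/N)). *)
Definition asymp f k := exists c : R, exists N0 : nat,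
  forall N, (N0 <= N)%N -> `|f N - N%:R ^ k| <= c * N%:R ^ (k - 1).

Lemma asymp_gt0 f k : asymp f k -> exists c : R, exists N0 : nat, 0 < c /\
  forall N, (N0 <= N)%N -> `|f N - N%:R ^ k| <= c * N%:R ^ (k - 1) /\ (0 < N)%N.
Proof.
case=> c [N0 H]; exists (`|c| + 1), N0.+1; split; first by rewrite ltr_wpDl.
move=> N lt_N; have N_gt0 := leq_ltn_trans (leq0n N0) lt_N.
split=> //; apply: le_trans (H N (ltnW lt_N)) _.
rewrite ler_pM2r ?exprz_gt0 ?ltr0n //.
by apply: le_trans (ler_norm c) _; rewrite lerDl.
Qed.

Lemma asympM f g k l : asymp f k -> asymp g l -> asymp (fun N => f N * g N) (k + l).
Proof.
move=> /asymp_gt0[c [N0 [c_gt0 fN]]] /asymp_gt0[c' [N1 [c'_gt0 gN]]].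
exists (c * (1 + c') + c'), (maxn N0 N1) => N; rewrite geq_max => /andP[/fN[fk N_gt0] /gN[gl _]].
have Np : 0 < N%:R :> R by rewrite ltr0n.
have Nu : (N%:R : R) != 0 by rewrite gt_eqF.
have g_le : `|g N| <= (1 + c') * N%:R ^ l.
  rewrite -(subrK (N%:R ^ l) (g N)) (le_trans (ler_normD _ _)) // mulrDl mul1r addrC.
  rewrite ger0_norm ?exprz_ge0 ?ler0n // lerD2l (le_trans gl) // ler_pM2l //.
  rewrite expfzDr // ler_piMr ?exprz_ge0 ?ler0n //.
  by rewrite invf_le1 // ler1n.
rewrite expfzDr // (_ : _ - _ = (f N - N%:R ^ k) * g N + N%:R ^ k * (g N - N%:R ^ l)); last first.
  by rewrite mulrBl mulrBr addrA subrK.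
apply: le_trans (ler_normD _ _) _; rewrite !normrM mulrDl lerD //.
  rewrite (_ : c * _ * _ = (c * N%:R ^ (k - 1)) * ((1 + c') * N%:R ^ l)).
    by rewrite ler_pM.
  by rewrite mulrACA -expfzDr // addrAC.
rewrite (ger0_norm (exprz_ge0 _ (ler0n _ _))).
rewrite (_ : c' * _ = N%:R ^ k * (c' * N%:R ^ (l - 1))).
  by rewrite ler_pM2l // exprz_gt0.
by rewrite mulrCA -expfzDr // addrA.
Qed.

Lemma asymp1 : asymp (fun=> 1) 0.
Proof. by exists 0, 0%N => N _; rewrite expr0z subrr normr0 mul0r. Qed.

Lemma asymp_prod (I : Type) (s : seq I) (F : I -> nat -> R) (e : I -> int) :
  (forall i, asymp (F i) (e i)) ->
  asymp (fun N => \prod_(i <- s) F i N) (\sum_(i <- s) e i).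
Proof.
move=> FE; elim: s => [|i s IHs].
  rewrite big_nil; have [c [N0 H]] := asymp1; exists c, N0 => N /H; by rewrite big_nil.
have [c [N0 H]] := asympM (FE i) IHs; exists c, N0 => N /H.
by rewrite !big_cons.
Qed.

Lemma asymp_ffact j : asymp (fun N => (N ^_ j)%:R) j%:Z.
Proof.
elim: j => [|j IHj]; first exact: asymp1.
have sub1 : asymp (fun N => (N - j)%:R) 1.
  exists j%:R, j.+1 => N /ltnW le_N.
  by rewrite subrr expr0z mulr1 expr1z natrB // addrAC subrr sub0r normrN normr_nat.
have [c [N0 H]] := asympM IHj sub1; exists c, N0 => N /H.
by rewrite ffactnSr natrM -addn1 PoszD.
Qed.

Lemma asymp_ffactV j : asymp (fun N => (N ^_ j)%:R^-1) (- j%:Z).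
Proof.
elim: j => [|j IHj].
  have [c [N0 H]] := asymp1; exists c, N0 => N /H.
  by rewrite ffactn0 invr1 oppr0.
have subV : asymp (fun N => (N - j)%:R^-1) (-1).
  exists (2 * j%:R), (2 * j).+1 => N lt_N.
  have lt_jN : (j < N)%N.
    by apply: leq_ltn_trans lt_N; rewrite leq_pmull.
  have Np : 0 < N%:R :> R by rewrite ltr0n (leq_ltn_trans _ lt_jN).
  have Mp : 0 < (N - j)%:R :> R by rewrite ltr0n subn_gt0.
  (* As N is at most 2 (N - j), the error j / (N (N - j)) is at most 2 j / N^2. *)
  have nE : N%:R = (N - j)%:R + j%:R :> R by rewrite -natrD subnK // ltnW.
  have le2 : N%:R <= 2 * (N - j)%:R :> R.
    have : (2 * j)%:R <= N%:R :> R by rewrite ler_nat ltnW.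
    by rewrite natrM nE; lra.
  rewrite -opprD -!invr_expz expr1z (_ : N%:R ^ (1 + 1) = N%:R ^+ 2) //.
  move: (ler0n R j) => j_ge0.
  move: (N%:R : R) ((N - j)%:R : R) (j%:R : R) Np Mp nE le2 j_ge0 => n M x Np Mp nE le2 x0.
  have -> : M^-1 - n^-1 = x / (M * n) by rewrite nE; field; rewrite !gt_eqF // -nE.
  have ge0 : 0 <= x / (M * n) by rewrite divr_ge0 // ltW // mulr_gt0.
  rewrite (ger0_norm ge0) -[2 * x]mulrC -mulrA ler_wpM2l //.
  rewrite ler_pdivlMr ?exprn_gt0 // mulrC ler_pdivrMr ?mulr_gt0 //.
  by rewrite expr2 mulrA ler_pM2r.
have [c [N0 H]] := asympM IHj subV; exists c, N0 => N /H.
by rewrite ffactnSr natrM invfM -addn1 PoszD opprD.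
Qed.

(** The terms with exponent K add up to their number times N^K, and the others, with
exponent at most K - 1, to an error term. *)
Lemma asymp_sum (I : Type) (s : seq I) (F : I -> nat -> R) (e : I -> int) K :
  (forall i, asymp (F i) (e i)) -> all (fun i => e i <= K) s ->
  exists c N0, 0 < c /\ forall N, (N0 <= N)%N ->
    `|\sum_(i <- s) F i N - (count (fun i => e i == K) s)%:R * N%:R ^ K| <= c * N%:R ^ (K - 1).
Proof.
move=> FE; elim: s => [_|i s IHs /= /andP[le_K /IHs[c [N0 [c_gt0 H]]]]].
  exists 1, 0%N; split=> // N _; rewrite big_nil mul0r subr0 normr0 mul1r.
  by rewrite exprz_ge0 // ler0n.
have [c' [N1 [c'_gt0 H']]] := asymp_gt0 (FE i).
exists (c + (c' + 1)), (maxn N0 N1); split; first by rewrite !addr_gt0.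
move=> N; rewrite geq_max => /andP[/H HN /H'[H'N N_gt0]]; rewrite big_cons natrD.
rewrite (_ : _ - _ = (\sum_(j <- s) F j N - (count (fun i => e i == K) s)%:R * N%:R ^ K)
   + (F i N - (e i == K)%:R * N%:R ^ K)); last by ring.
rewrite mulrDl (le_trans (ler_normD _ _)) // lerD //.
have N1' : 1 <= N%:R :> R by rewrite ler1n.
have Np : 0 <= N%:R ^ (K - 1) :> R by rewrite exprz_ge0 ?ler0n.
have [eK|neK] := eqVneq (e i) K.
  by rewrite mul1r -eK in Np *; rewrite (le_trans H'N) // ler_wpM2r // lerDl.
have lt_K : e i <= K - 1 by rewrite lerBrDr lezD1 lt_neqAle neK.
rewrite mul0r subr0 -[F i N](subrK (N%:R ^ e i)) (le_trans (ler_normD _ _)) // mulrDl mul1r lerD //.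
  by rewrite (le_trans H'N) // ler_pM2l // ler_weXz2l // (le_trans _ lt_K) // gerBl.
by rewrite ger0_norm ?exprz_ge0 ?ler0n // ler_weXz2l.
Qed.

End Asymptotics.

(** * Counting permutations that follow a given walk *)

Section PermExtension.
Variable T : finType.
Implicit Types (s t : seq T).

Lemma perm_extend s t : uniq s -> uniq t -> size s = size t ->
  exists p : {perm T}, map p s = t.
Proof.
elim: s t => [|x s IHs] [|y t] //= => [_ _ _|]; first by exists 1%g.
move=> /andP[xs us] /andP[yt ut] [sz]; have [p pE] := IHs t us ut sz.
exists (p * tperm (p x) y)%g; rewrite permM tpermL; congr cons.
rewrite -pE; apply/eq_in_map => z zs; rewrite permM tpermD //.
  by apply: contraNneq xs => /perm_inj ->.
by apply: contraNneq yt => ->; rewrite -pE map_f.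
Qed.

(** Every permutation maps s to exactly one sequence t without repetitions, and
multiplication by a permutation that maps t to t' shows that the number of
permutations does not depend on t. *)
Lemma card_perm_extend s t : uniq s -> uniq t -> size s = size t ->
  #|[set p : {perm T} | map p s == t]| * #|T| ^_ size s = #|{perm T}|.
Proof.
move=> us ut sz; pose U := [set t' : (size s).-tuple T | uniq t'].
have -> : #|T| ^_ size s = #|U|.
  rewrite -card_uniq_tuples; apply: eq_card => t'; rewrite !inE.
  by rewrite (eq_all (a2 := predT)) ?all_predT.
rewrite -[RHS]cardsT -[RHS]sum1_card mulnC -sum_nat_const.
rewrite (partition_big (fun p : {perm T} => [tuple of map p (in_tuple s)]) (mem U)) /=.
  apply: eq_bigr => t' t'U; rewrite sum1_card.
  have ut' : uniq t' by rewrite inE in t'U.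
  have [c cE] := perm_extend ut ut' (etrans (esym sz) (esym (size_tuple t'))).
  rewrite -[LHS](card_imset _ (mulIg c)); apply: eq_card => p.
  rewrite [RHS]unfold_in /= finset.in_setT /=.
  apply/imsetP/eqP => [[p' /[!inE] /eqP p'E ->]|].
    by apply: val_inj; rewrite /= -cE -p'E -map_comp; apply: eq_map => z; rewrite /= permM.
  move=> /(congr1 val)/= pE; exists (p * c^-1)%g; last by rewrite mulgKV.
  rewrite inE (eq_map (g := c^-1%g \o p)); last by move=> z; rewrite /= permM.
  by rewrite map_comp pE -cE -map_comp (eq_map (g := id)) ?map_id // => z; rewrite /= permK.
by move=> p _; rewrite !inE /= map_inj_uniq //; exact: perm_inj.
Qed.

End PermExtension.

Section PermWalks.
Context (X : choiceType) (T : finType).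
Implicit Types (s : X -> {perm T}).

Definition perm_step s (u : T) (a : X * bool) : T :=
  if a.2 then (s a.1)^-1%g u else s a.1 u.

Definition perm_walk s u (l : seq (X * bool)) := scanl (perm_step s) u l.

Lemma perm_step_reversible s : reversible (perm_step s).
Proof. by move=> u [x []]; rewrite /perm_step /= ?permKV ?permK. Qed.

Lemma perm_walk_edge s u l e :
  e \in edges u (perm_walk s u l) l -> s e.1 e.2.1 = e.2.2.
Proof. exact: (walk_edge (perm_step_reversible s)). Qed.

End PermWalks.

Section Patterns.
Variable L : nat.
Implicit Type T : eqType.

(** Naming each vertex by its first position makes the relabelled walk depend only on
which positions are at the same vertex. *)
Definition label T (u : T) vs v : 'I_L.+1 := inord (index v (u :: vs)).

Definition pattern T (u : T) vs := map (label u vs) vs.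

Lemma label_root T (u : T) vs : label u vs u = ord0.
Proof. by apply/val_inj; rewrite /= inordK //= eqxx. Qed.

Lemma label_inj T (u : T) vs : size vs <= L -> {in u :: vs &, injective (label u vs)}.
Proof.
move=> le_L v v' vin v'in /(congr1 val) /=.
have lt z : z \in u :: vs -> index z (u :: vs) < L.+1.
  by rewrite -index_mem /= => lt_z; apply: leq_trans lt_z _; rewrite ltnS.
rewrite !inordK ?lt // => eq_i.
by rewrite -(nth_index u vin) eq_i nth_index.
Qed.

Lemma index_map_in (T T' : eqType) (f : T -> T') (s : seq T) v :
  {in s &, injective f} -> v \in s -> index (f v) (map f s) = index v s.
Proof.
elim: s => //= x s IHs finj vin.
case: (eqVneq x v) vin => [-> _|xv]; first by rewrite eqxx.
rewrite in_cons eq_sym (negbTE xv) /= => vin.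
case: eqP => [/finj xv'|_]; first by case/eqP: xv; apply: xv'; rewrite ?inE ?eqxx ?vin ?orbT.
rewrite IHs // => y z ys zs; apply: finj; rewrite inE ?ys ?zs orbT //.
Qed.

Lemma pattern_map (T T' : eqType) (f : T -> T') (u : T) vs :
  {in u :: vs &, injective f} -> pattern (f u) (map f vs) = pattern u vs.
Proof.
move=> finj; rewrite /pattern -map_comp; apply/eq_in_map => v vin /=.
by rewrite /label -[_ :: _]/(map f (u :: vs)) index_map_in // inE vin orbT.
Qed.

Lemma pattern_pattern T (u : T) vs : size vs <= L ->
  pattern ord0 (pattern u vs) = pattern u vs.
Proof.
move=> le_L; rewrite -[in LHS](label_root u vs); apply: pattern_map.
exact: label_inj.
Qed.

End Patterns.

Section Count.
Variables (X : finType) (l : seq (X * bool)).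
Let L := size l.
Implicit Type Q : L.-tuple 'I_L.+1.

Definition vertex_count Q := distinct (ord0 :: (Q : seq _)).
Definition edge_count Q x := distinct [seq e <- edges ord0 Q l | e.1 == x].

(** The patterns of balanced loops; the root of a pattern is [ord0], the label of the
starting point of any walk. *)
Definition admissible m Q := [&& pattern L ord0 Q == Q, folded (edges ord0 Q l),
  last ord0 Q == ord0 & balanced m ord0 Q l].

Lemma size_perm_walk N (rho : X -> 'S_N) i : size (perm_walk rho i l) = L.
Proof. by rewrite size_scanl. Qed.

Lemma perm_walkP N (rho : X -> 'S_N) i vs : size vs = L ->
  reflect (forall e, e \in edges i vs l -> rho e.1 e.2.1 = e.2.2) (perm_walk rho i l == vs).
Proof.
move=> sz; apply: (iffP eqP) => [<- e|]; first exact: perm_walk_edge.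
rewrite /perm_walk /L in sz *; elim: l i vs sz => [|a l' IHl] i [|v vs] //= [sz] H.
have -> : perm_step rho i a = v.
  have := H (dart i v a).1 (mem_head _ _); rewrite /perm_step /dart /=.
  by case: a.2 => //= <-; rewrite permK.
congr cons; apply: IHl => // e eE; apply: H; exact: mem_behead.
Qed.

Definition balanced_loop m N (p : 'I_N * {ffun X -> 'S_N}) : bool :=
  (foldl (perm_step p.2) p.1 l == p.1) && balanced m p.1 (perm_walk p.2 p.1 l) l.

Definition loop_count m N := #|[pred p | @balanced_loop m N p]|.

(** The conditions on the permutations of distinct letters are independent, and the
condition on the permutation of x is to extend the partial injection formed by the
edges with label x. *)
Lemma card_walk_perms N (i : 'I_N) vs : size vs = L -> folded (edges i vs l) ->
  #|[set rho : {ffun X -> 'S_N} | perm_walk rho i l == vs]| *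
    \prod_x (N ^_ distinct [seq e <- edges i vs l | e.1 == x]) = N`! ^ #|X|.
Proof.
move=> sz /foldedP fold.
pose E x := undup [seq e <- edges i vs l | e.1 == x].
have EP x e : e \in E x -> e \in edges i vs l /\ e.1 = x.
  by rewrite mem_undup mem_filter => /andP[/eqP].
pose c x := #|[set p : 'S_N | map p [seq e.2.1 | e <- E x] == [seq e.2.2 | e <- E x]]|.
have cE x : c x * N ^_ size (E x) = N`!.
  have uniqE (g : X * ('I_N * 'I_N) -> 'I_N) : {in E x &, injective g} -> uniq (map g (E x)).
    by move=> ginj; rewrite map_inj_in_uniq ?undup_uniq.
  have /= := @card_perm_extend 'I_N [seq e.2.1 | e <- E x] [seq e.2.2 | e <- E x].
  rewrite !size_map card_ord -card_Sn; apply => //; apply: uniqE.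
    move=> [x1 [a b]] [x2 [a' b']] /EP[/= eE x1x] /EP[/= e'E x2x] aa'; subst x1 x2 a'.
    by have := fold _ _ eE e'E erefl; rewrite /= eqxx => /esym/eqP ->.
  move=> [x1 [a b]] [x2 [a' b']] /EP[/= eE x1x] /EP[/= e'E x2x] aa'; subst x1 x2 b'.
  by have := fold _ _ eE e'E erefl; rewrite /= eqxx => /eqP ->.
have -> : #|[set rho : {ffun X -> 'S_N} | perm_walk rho i l == vs]| = \prod_x c x.
  rewrite (eq_bigr (fun x => \sum_(p : 'S_N)
    (map p [seq e.2.1 | e <- E x] == [seq e.2.2 | e <- E x] : nat))); last first.
    by move=> x _; rewrite /c -sum1dep_card big_mkcond.
  rewrite bigA_distr_bigA /= -sum1dep_card big_mkcond /=; apply: eq_bigr => rho _.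
  case: perm_walkP => // [H|H].
    rewrite big1 // => x _; rewrite -map_comp.
    suff -> : [seq rho x e.2.1 | e <- E x] = [seq e.2.2 | e <- E x] by rewrite eqxx.
    by apply/eq_in_map => e /EP[eE <-]; exact: H.
  have [/forallP ext|] := boolP [forall x,
      map (rho x) [seq e.2.1 | e <- E x] == [seq e.2.2 | e <- E x]].
    case: H => e eE; have /eqP := ext e.1; rewrite -map_comp => /eq_in_map; apply.
    by rewrite mem_undup mem_filter eqxx.
  by rewrite negb_forall => /existsP[x /negbTE ext]; rewrite (bigD1 x) //= ext.
rewrite -big_split /= (eq_bigr (fun=> N`!)) => [|x _]; last exact: cE.
by rewrite prod_nat_const.
Qed.

Lemma edge_count_pattern N (i : 'I_N) vs Q x : size vs = L -> pattern L i vs = Q ->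
  distinct [seq e <- edges i vs l | e.1 == x] = edge_count Q x.
Proof.
move=> sz QE; have inj := @relabel_inj_in X _ _ _ i vs l (label_inj (eq_leq sz)).
rewrite /edge_count -QE -[ord0](label_root L i vs) edges_map filter_map /=.
rewrite distinct_map // => e e'; rewrite !mem_filter => /andP[_ eE] /andP[_ e'E].
exact: inj.
Qed.

(** A walk with pattern Q amounts to an injective naming of the vertices of Q. *)
Lemma card_pattern_vertices N Q : pattern L ord0 Q = Q ->
  #|[set p : 'I_N * L.-tuple 'I_N | pattern L p.1 p.2 == Q]| = N ^_ vertex_count Q.
Proof.
move=> QQ; set V := vertex_count Q.
have V_gt0 : 0 < V.
  by rewrite /V /vertex_count /distinct -has_predT; apply/hasP; exists ord0;
    rewrite ?mem_undup ?mem_head.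
pose idx q : 'I_V := insubd (Ordinal V_gt0) (index q (undup (ord0 :: Q))).
have idxE q : q \in ord0 :: (Q : seq _) -> idx q = index q (undup (ord0 :: Q)) :> nat.
  by move=> qin; rewrite /idx val_insubd index_mem mem_undup qin.
have idx_inj : {in ord0 :: (Q : seq _) &, injective idx}.
  move=> q q' qin q'in /(congr1 val); rewrite /= !idxE // => eq_i.
  by rewrite -(@nth_index _ ord0 q (undup (ord0 :: Q))) ?mem_undup // eq_i nth_index ?mem_undup.
(* The walk whose vertices are named by h. *)
pose F (h : {ffun 'I_V -> 'I_N}) : 'I_N * L.-tuple 'I_N :=
  (h (idx ord0), [tuple of map (h \o idx) Q]).
rewrite -[N in RHS]card_ord -[V in RHS]card_ord -card_inj_ffuns.
have F_inj : injective F.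
  move=> h h' eqF; apply/ffunP => k.
  pose q := nth ord0 (undup (ord0 :: Q)) k.
  have qin : q \in ord0 :: (Q : seq _) by rewrite -mem_undup mem_nth.
  have <- : idx q = k by apply/val_inj; rewrite /= idxE // index_uniq ?undup_uniq.
  move: qin; rewrite inE => /predU1P[->|qQ]; first by have [] := eqF.
  by have := congr1 (fun p => val p.2) eqF; move=> /eq_in_map/(_ q qQ).
rewrite -(card_imset _ F_inj); apply: eq_card => -[i vs]; rewrite !inE /=.
apply/eqP/imsetP => [QE|[h /[!inE] /injectiveP hinj [-> ->]]]; last first.
  have /= -> // := @pattern_map L _ _ (h \o idx) ord0 Q.
  by move=> q q' qin q'in /hinj; exact: idx_inj.
have sz : size vs <= L by rewrite size_tuple.
have QM : ord0 :: (Q : seq _) = map (label L i vs) (i :: vs).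
  by rewrite /= label_root -[X in _ :: X]QE.
pose h : {ffun 'I_V -> 'I_N} := [ffun k : 'I_V =>
  nth i (i :: vs) (index (nth ord0 (undup (ord0 :: Q)) k) (ord0 :: Q))].
have hE v : v \in i :: (vs : seq _) -> h (idx (label L i vs v)) = v.
  move=> vin; have lin : label L i vs v \in ord0 :: (Q : seq _).
    by rewrite QM map_f.
  rewrite ffunE idxE // nth_index ?mem_undup // QM.
  by rewrite index_map_in ?nth_index //; exact: label_inj.
exists h.
  rewrite inE; apply/injectiveP => k k'.
  have kE (k0 : 'I_V) : exists2 v, v \in i :: (vs : seq _) & k0 = idx (label L i vs v).
    pose q := nth ord0 (undup (ord0 :: Q)) k0.
    have qin : q \in ord0 :: (Q : seq _) by rewrite -mem_undup mem_nth.
    have k0E : k0 = idx q by apply/val_inj; rewrite /= idxE // index_uniq ?undup_uniq.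
    by move: qin; rewrite QM => /mapP[v vin qv]; exists v; rewrite // -qv.
  by have [v vin ->] := kE k; have [v' v'in ->] := kE k'; rewrite !hE // => ->.
congr (_, _); first by rewrite -(label_root L i vs) hE ?mem_head.
apply: val_inj; rewrite /= -QE -map_comp -[LHS]map_id; apply/eq_in_map => v vin /=.
by rewrite hE // mem_behead.
Qed.

Lemma card_pattern N Q : pattern L ord0 Q = Q -> folded (edges ord0 Q l) ->
  #|[set p : 'I_N * {ffun X -> 'S_N} | pattern L p.1 (perm_walk p.2 p.1 l) == Q]| *
    \prod_x (N ^_ edge_count Q x) = N ^_ vertex_count Q * N`! ^ #|X|.
Proof.
move=> QQ fold; rewrite -card_pattern_vertices // -sum1dep_card.
pose W (p : 'I_N * {ffun X -> 'S_N}) : 'I_N * L.-tuple 'I_N :=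
  (p.1, Tuple (introT eqP (size_perm_walk p.2 p.1))).
rewrite (partition_big W (fun p => pattern L p.1 p.2 == Q)) //=.
rewrite big_distrl /= -sum_nat_const; under [RHS]eq_bigl do rewrite inE.
apply: eq_bigr => -[i vs] /= /eqP QE.
rewrite -(card_walk_perms (i := i) (size_tuple vs)); last first.
  have := @folded_relabel X _ _ (label L i vs) i vs l (label_inj (eq_leq (size_tuple vs))).
  by rewrite label_root -[map _ _]/(pattern L i vs) QE fold.
rewrite [X in _ = _ * X](eq_bigr (fun x => N ^_ edge_count Q x)) => [|x _]; last first.
  by rewrite (edge_count_pattern x (size_tuple vs) QE).
congr (_ * _); rewrite sum1dep_card.
rewrite -[RHS](@card_imset _ _ (pair i)) => [|rho rho' [] //].
apply: eq_card => -[j rho]; rewrite !inE /W; apply/andP/imsetP => /=.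
  case=> _ /eqP/(congr1 (fun p => (p.1, val p.2)))/= [-> vsE].
  by exists rho; rewrite // inE vsE.
case=> rho' /[!inE] /eqP rho'E [-> ->]; split; first by rewrite rho'E QE.
by apply/eqP; congr pair; apply: val_inj.
Qed.

Lemma balanced_loop_pattern m N (p : 'I_N * {ffun X -> 'S_N}) Q :
  pattern L p.1 (perm_walk p.2 p.1 l) = Q ->
  balanced_loop m p = admissible m Q.
Proof.
rewrite /balanced_loop => QE; set vs := perm_walk p.2 p.1 l.
have le_L : size vs <= L by rewrite size_perm_walk.
have inj := label_inj (u := p.1) le_L.
rewrite /admissible -QE pattern_pattern // eqxx /= /pattern -[ord0](label_root L p.1 vs).
rewrite folded_relabel // folded_walk; last exact: perm_step_reversible.
rewrite balanced_map // last_map -last_scanl -/(perm_walk _ _ _) -/vs /=.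
congr (_ && _); apply/eqP/eqP => [->//|]; apply: inj; first exact: mem_last.
exact: mem_head.
Qed.

(** The contribution of the pattern Q to the mean trace. *)
Definition pattern_term (R : fieldType) Q N : R :=
  ((N ^_ vertex_count Q)%:R * \prod_x (N ^_ edge_count Q x)%:R^-1)%R.

Lemma edge_count_le Q x : edge_count Q x <= L.
Proof.
apply: leq_trans (size_undup _) _; rewrite size_filter; apply: leq_trans (count_size _ _) _.
by rewrite size_map size_darts.
Qed.

(** The loops are sorted by their patterns, which are admissible. *)
Lemma loop_countE (R : numFieldType) m N : L <= N ->
  ((loop_count m N)%:R / (N`! ^ #|X|)%:R : R)%R =
  (\sum_(Q | admissible m Q) pattern_term R Q N)%R.
Proof.
move=> le_N; have F0 : ((N`! ^ #|X|)%:R != 0 :> R)%R.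
  by rewrite Num.Theory.pnatr_eq0 -lt0n expn_gt0 fact_gt0.
rewrite /loop_count -sum1_card.
pose pat (p : 'I_N * {ffun X -> 'S_N}) : L.-tuple 'I_L.+1 :=
  insubd [tuple of nseq L ord0] (pattern L p.1 (perm_walk p.2 p.1 l)).
have patE p : pat p = pattern L p.1 (perm_walk p.2 p.1 l) :> seq _.
  by rewrite val_insubd size_map size_perm_walk eqxx.
rewrite (partition_big pat (admissible m)) => [|p]; last first.
  by rewrite inE (balanced_loop_pattern m (esym (patE p))).
rewrite GRing.natr_sum GRing.mulr_suml; apply: eq_bigr => Q adm.
apply: (GRing.mulIf F0); rewrite GRing.divfK // /pattern_term.
case/and4P: (adm) => /eqP QQ fold _ _.
have := congr1 (fun n => n%:R : R)%R (card_pattern N QQ fold).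
rewrite !GRing.natrM GRing.natr_prod => cardE.
rewrite GRing.mulrAC -cardE -GRing.mulrA -big_split /= [X in (_ * X)%R]big1 => [|x _]; last first.
  rewrite GRing.mulfV // Num.Theory.pnatr_eq0 -lt0n ffact_gt0.
  exact: leq_trans (edge_count_le Q x) le_N.
rewrite GRing.mulr1 sum1_card; congr (_%:R)%R; apply: eq_card => p.
rewrite unfold_in inE [RHS]inE -(patE p) [X in _ && X]/(val (pat p) == val Q).
apply: andb_idl => /eqP QE.
by rewrite (balanced_loop_pattern m (etrans (esym (patE p)) QE)).
Qed.

Lemma loop_count_eq0 m N : (forall Q, ~~ admissible m Q) -> loop_count m N = 0.
Proof.
move=> noQ; apply/eq_card0 => p; rewrite !inE.
have szp : size (pattern L p.1 (perm_walk p.2 p.1 l)) == L by rewrite size_map size_perm_walk.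
rewrite (@balanced_loop_pattern m N p (Tuple szp)) //.
exact: negbTE.
Qed.

Lemma pattern_term_asymp (R : realFieldType) Q :
  asymp (pattern_term R Q) ((vertex_count Q)%:Z - (\sum_x edge_count Q x)%:Z)%R.
Proof.
rewrite (_ : (_ - _)%R = ((vertex_count Q)%:Z + \sum_x - (edge_count Q x)%:Z)%R); last first.
  by rewrite GRing.sumrN (big_morph Posz PoszD (erefl (Posz 0))).
apply: asympM; first exact: asymp_ffact.
by apply: asymp_prod => x; apply: asymp_ffactV.
Qed.

Lemma sum_edge_count Q : \sum_x edge_count Q x = distinct (edges ord0 Q l).
Proof.
rewrite /distinct -sum1_size.
under eq_bigr do rewrite /edge_count /distinct -filter_undup size_filter -sum1_count.
by rewrite (exchange_big_dep xpredT) //=; apply: eq_bigr => e _;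
  rewrite (big_pred1 e.1) // => x; rewrite /= eq_sym.
Qed.

End Count.

(** * Patterns and subgroups *)

Section PatternTransfer.
Local Open Scope classical_set_scope.

(** The two lists of vertices differ by an injective relabelling. *)
Lemma same_kernel_pattern L (T T' : eqType) (u : T) vs (u' : T') vs' :
  size vs = L -> size vs' = L ->
  (forall i j, i <= L -> j <= L ->
    nth u (u :: vs) i = nth u (u :: vs) j <-> nth u' (u' :: vs') i = nth u' (u' :: vs') j) ->
  pattern L u vs = pattern L u' vs'.
Proof.
move=> sz sz' ker; pose P := u :: vs; pose P' := u' :: vs'.
pose f v := nth u' P' (index v P).
have idx v : v \in P -> index v P <= L by rewrite -index_mem /= sz ltnS.
have fE i : i <= L -> f (nth u P i) = nth u' P' i.
  move=> le_i; have in_P : nth u P i \in P by rewrite mem_nth //= sz.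
  by apply/(ker _ _ (idx _ in_P) le_i); rewrite nth_index.
have finj : {in P &, injective f}.
  move=> v v' vP v'P eq_f; have /(ker _ _ (idx _ vP) (idx _ v'P)) := eq_f.
  by rewrite !nth_index.
rewrite -(pattern_map L finj) -[f u]/(f (nth u P 0)) fE //=.
congr (pattern L _ _); apply: (@eq_from_nth _ u'); rewrite size_map ?sz ?sz' // => i lt_i.
by rewrite (nth_map u) ?sz // -[nth u vs i]/(nth u P i.+1) fE.
Qed.

Lemma walk_group_pattern (X : choiceType) (T : eqType) (u : T) vs (l : seq (X * bool)) :
  size vs = size l ->
  walk_group ord0 (pattern (size l) u vs) l = walk_group u vs l.
Proof.
move=> sz; set L := size l.
have nthE i : i <= L -> nth ord0 (ord0 :: pattern L u vs) i = label L u vs (nth u (u :: vs) i).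
  move=> le_i; rewrite -[in LHS](label_root L u vs).
  rewrite -[_ :: pattern _ _ _]/(map (label L u vs) (u :: vs)).
  by rewrite (nth_map u) //= sz.
rewrite /walk_group; apply: (congr1 (@Defs.generated _)); apply/seteqP.
split=> g [i [j [le_i le_j eq_ij ->]]]; exists i, j; split=> //.
  move: eq_ij; rewrite !nthE // => /label_inj; apply; rewrite ?sz ?mem_nth //= sz ltnS //.
by rewrite !nthE // eq_ij.
Qed.

End PatternTransfer.

Section Bijection.
Local Open Scope classical_set_scope.
Variables (r : nat) (m : option nat) (w : free_group 'I_r).
Let L := size w.
Local Notation F := (free_group 'I_r).
Implicit Type Q : L.-tuple 'I_L.+1.

Definition pattern_rank Q := distinct (edges ord0 Q w) + 1 - vertex_count Q.
Definition pattern_group Q : set F := walk_group ord0 Q w.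

(** The number of tuples of permutations given by [card_walk_perms] is not 0. *)
Lemma admissible_walk Q : admissible m Q ->
  exists rho : 'I_r -> 'S_L.+1, scanl (perm_step rho) ord0 w = Q.
Proof.
case/and4P => _ fold _ _.
have := @card_walk_perms 'I_r w L.+1 ord0 Q (size_tuple Q) fold.
case: (set_0Vmem [set rho : {ffun 'I_r -> 'S_L.+1} | perm_walk rho ord0 w == Q]) => [->|[rho]].
  by rewrite cards0 mul0n => /esym/eqP; rewrite expn_eq0 -[_`! == 0]negbK -lt0n fact_gt0.
by rewrite inE => /eqP rhoQ _; exists rho.
Qed.

(** Permutations that realize Q turn it into the walk of a reversible system, to which
the description of walk groups applies. *)
Lemma admissible_group Q : admissible m Q ->
  [/\ has_rank (pattern_group Q) (pattern_rank Q), is_subgroup (pattern_group Q),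
    Kker m (pattern_group Q) w,
    pattern_rank Q + vertex_count Q = distinct (edges ord0 Q w) + 1 &
    forall i j, i <= L -> j <= L ->
      pattern_group Q (wordprod (@gen _) (take i w) * (wordprod (@gen _) (take j w))^-1)%g <->
      nth ord0 (ord0 :: (Q : seq _)) i = nth ord0 (ord0 :: (Q : seq _)) j].
Proof.
move=> adm; have [rho rhoQ] := admissible_walk adm.
case/and4P: (adm) => _ _ /eqP loop bal.
have stK := perm_step_reversible rho.
have [t [TE tree]] := @spanning_tree_exists 'I_r _ ord0
  (scanl (perm_step rho) ord0 w) w (size_scanl _ _ _).
have sz := size_closing_edges tree.
have rk : pattern_rank Q = size (closing_edges (perm_step rho) ord0 w TE).
  by rewrite /pattern_rank /vertex_count -rhoQ -sz addnK.
have loop' : foldl (perm_step rho) ord0 w = ord0 by rewrite -last_scanl rhoQ.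
rewrite /pattern_group; split.
- rewrite rk -rhoQ; exists (basis_loop t (TE := TE)); exact: walk_group_is_basis.
- exact: walk_group_subgroup.
- rewrite -rhoQ -[X in Kker _ _ X]wordprod_word.
  by apply: (Kker_walk_group stK tree) => //; rewrite rhoQ.
- by rewrite rk /vertex_count -rhoQ.
move=> i j le_i le_j; rewrite -rhoQ.
exact: (walk_group_kernel stK ord0 le_i le_j).
Qed.

(** The subgroup determines which prefixes of w end at the same vertex. *)
Lemma pattern_group_inj : {in [pred Q | admissible m Q] &, injective pattern_group}.
Proof.
move=> Q Q' adm adm' eqG; apply: val_inj.
have [_ _ _ _ kerQ] := admissible_group adm; have [_ _ _ _ kerQ'] := admissible_group adm'.
case/and4P: (adm) => /eqP QQ _ _ _; case/and4P: (adm') => /eqP QQ' _ _ _.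
rewrite -[val Q]QQ -[val Q']QQ'.
apply: same_kernel_pattern; rewrite ?size_tuple // => i j le_i le_j.
by rewrite -kerQ // eqG kerQ'.
Qed.

Lemma Kker_mem H : is_subgroup H -> Kker m H w -> H w.
Proof.
move=> sH; case: m => [k|] /=; first by case=> I [b [[_ <-] [u [-> _]]]]; exists u.
move=> /(_ H sH); apply=> _ [g Hg [h Hh <-]].
have [H1 HM HV] := sH; rewrite /commg /conjg; have HVg := HV _ Hg; have HVh := HV _ Hh.
exact: (HM _ _ HVg (HM _ _ HVh (HM _ _ Hg Hh))).
Qed.

(** Q is the pattern of the walk of w in the graph of the cosets of H. *)
Lemma subgroup_pattern H n : is_subgroup H -> has_rank H n -> Kker m H w ->
  exists2 Q, admissible m Q & pattern_rank Q <= n /\ (pattern_rank Q = n -> pattern_group Q = H).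
Proof.
move=> sH [b bH] KHw; have Hw := Kker_mem sH KHw.
set vs := scanl (@coset_step _) H w.
have sz : size vs = L by rewrite size_scanl.
have szQ : size (pattern L H vs) == L by rewrite size_map sz.
pose Q := Tuple szQ; have inj := label_inj (u := H) (eq_leq sz).
have Hw' : H (wordprod (@gen _) w) by rewrite wordprod_word.
have adm : admissible m Q.
  rewrite /admissible /= pattern_pattern ?sz // eqxx /=.
  rewrite /pattern -[ord0](label_root L H vs) folded_relabel // last_map balanced_map //.
  rewrite folded_walk /=; last exact: coset_reversible.
  rewrite last_scanl (_ : foldl _ _ _ = H) ?eqxx /=; last by apply/coset_loop.
  by apply: balanced_Kker => //; rewrite wordprod_word.
have [_ _ _ rk _] := admissible_group adm.
have dV : vertex_count Q = distinct (H :: vs).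
  by rewrite -(distinct_map inj) /= label_root.
have dE : distinct (edges ord0 Q w) = distinct (edges H vs w).
  rewrite /= /pattern -[ord0](label_root L H vs) edges_map distinct_map //.
  exact: relabel_inj_in.
exists Q => //; have := rank_le sH w bH; rewrite -/vs => le_n.
have arith p q c : (p + q = c + 1 -> c + 1 <= n + q -> p <= n)%N by lia.
rewrite dV dE in rk; split; first exact: arith rk le_n.
move=> rkn; rewrite /pattern_group /= walk_group_pattern //.
apply: (walk_group_full sH bH) => //; rewrite -/vs.
by rewrite -rkn rk.
Qed.

End Bijection.

(** * Monomial matrices and averages over phases *)

Section Monomial.
Local Open Scope ring_scope.
Context (K : fieldType) (N : nat).

Definition monomial (z : 'I_N -> K) (s : 'S_N) : 'M[K]_N :=
  \matrix_(i, j) (z i *+ (s i == j)).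

Lemma monomialM y z s t :
  monomial y s *m monomial z t = monomial (fun i => y i * z (s i)) (s * t)%g.
Proof.
apply/matrixP => i k; rewrite !mxE permM (bigD1 (s i)) //= !mxE eqxx mulr1n.
rewrite mulrnAr big1 ?addr0 // => j /negbTE ji.
by rewrite !mxE eq_sym ji mulr0n mul0r.
Qed.

Lemma monomial1 : monomial (fun=> 1) 1%g = 1%:M.
Proof. by apply/matrixP => i j; rewrite !mxE perm1. Qed.

Lemma invmx_monomial z s : (forall i, z i != 0) ->
  invmx (monomial z s) = monomial (fun j => (z (s^-1%g j))^-1) s^-1%g.
Proof.
move=> z0; set B := RHS.
have AB : monomial z s *m B = 1%:M.
  rewrite monomialM -monomial1 mulgV; apply/matrixP => i j.
  by rewrite !mxE permK mulfV.
have [Au _] := mulmx1_unit AB.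
by rewrite -[LHS]mulmx1 -AB mulmxA mulVmx // mul1mx.
Qed.

Context (X : finType) (z : X * 'I_N -> K) (s : X -> 'S_N).
Hypothesis z0 : forall e, z e != 0.

Lemma subst_word_monomial (w : free_group X) :
  subst_word 1%:M mulmx invmx (fun x => monomial (fun u => z (x, u)) (s x)) w =
  \matrix_(i, j) ((\prod_(d <- darts i (perm_walk s i w) w)
    (if d.2 then (z (d.1.1, d.1.2.1))^-1 else z (d.1.1, d.1.2.1)))
      *+ (foldl (perm_step s) i w == j)).
Proof.
rewrite /subst_word; elim: (word w) => [|a l IHl].
  by rewrite big_nil; apply/matrixP => i j; rewrite !mxE big_nil.
rewrite big_cons IHl; apply/matrixP => i j; rewrite mxE.
set M := (if a.2 then _ else _).
have ME k : M i k = (if a.2 then (z (a.1, perm_step s i a))^-1 else z (a.1, i))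
    *+ (perm_step s i a == k).
  by rewrite /M /perm_step; case: a.2; rewrite ?invmx_monomial // !mxE.
rewrite (bigD1 (perm_step s i a)) //= ME eqxx mulr1n big1 ?addr0; last first.
  by move=> k /negbTE ki; rewrite ME eq_sym ki mulr0n mul0r.
rewrite !mxE /= big_cons mulrnAr; congr (_ * _ *+ _).
by rewrite /dart /=; case: a.2.
Qed.

Lemma prod_darts (I : Type) (D : seq (I * bool)) (f : I -> X * 'I_N) :
  \prod_(d <- D) (if d.2 then (z (f d.1))^-1 else z (f d.1)) =
  \prod_e z e ^ (\sum_(d <- D | f d.1 == e) (-1) ^+ d.2).
Proof.
elim: D => [|d D IHD].
  by rewrite big_nil big1 // => e _; rewrite big_nil expr0z.
rewrite big_cons IHD (bigD1 (f d.1)) //= [in RHS](bigD1 (f d.1)) //= mulrA.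
congr (_ * _); last first.
  by apply: eq_bigr => e /negbTE de; rewrite big_cons eq_sym de.
rewrite big_cons eqxx expfzDr ?z0 //; congr (_ * _).
by case: d.2.
Qed.

Lemma mxtrace_word_monomial (w : free_group X) :
  \tr (subst_word 1%:M mulmx invmx (fun x => monomial (fun u => z (x, u)) (s x)) w) =
  \sum_(i | foldl (perm_step s) i w == i)
    \prod_(e : X * 'I_N) z e ^ crossing i (perm_walk s i w) w (e.1, (e.2, s e.1 e.2)).
Proof.
rewrite subst_word_monomial /mxtrace [RHS]big_mkcond /=; apply: eq_bigr => i _.
rewrite mxE; case: eqP => // _; rewrite mulr1n.
rewrite (prod_darts _ (fun e => (e.1, e.2.1))); apply: eq_bigr => -[x u] _.
congr (_ ^ _); rewrite /crossing big_seq_cond [RHS]big_seq_cond.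
apply: eq_bigl => d; case: (boolP (d \in _)) => //= dD.
have := @perm_walk_edge _ _ s i w d.1 (map_f fst dD).
case: d.1 => y [a b] /= <-; rewrite !xpair_eqE /=.
by apply: andb_id2l => /eqP ->; case: eqP => [->|]; rewrite /= ?eqxx.
Qed.

End Monomial.

Section Average.
Local Open Scope ring_scope.
Context (K : fieldType) (X : finType) (N q : nat) (zeta : K).
Hypotheses (zeta_prim : q.-primitive_root zeta).

Lemma sum_unity_root (z : K) : z ^+ q = 1 ->
  \sum_(t < q) z ^+ t = if z == 1 then q%:R else 0.
Proof.
move=> zq; case: eqP => [->|/eqP z1].
  by under eq_bigr do rewrite expr1n; rewrite sumr_const card_ord.
have := subrX1 z q; rewrite zq subrr => /esym/eqP.
by rewrite mulf_eq0 subr_eq0 (negbTE z1) => /eqP.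
Qed.

Lemma zeta_neq0 : zeta != 0.
Proof.
apply/eqP => z0; have := prim_expr_order zeta_prim.
rewrite z0 expr0n; case: q (prim_order_gt0 zeta_prim) => //= _ _ /eqP.
by rewrite eq_sym oner_eq0.
Qed.

Lemma prim_exprz_eq1 (c : int) : (zeta ^ c == 1) = (q %| c)%Z.
Proof.
case: c => n.
  by rewrite -[X in X == 1]/(zeta ^+ n) -(prim_order_dvd zeta_prim).
rewrite NegzE -exprz_inv -exprnP exprVn invr_eq1.
by rewrite -[RHS]/(q %| n.+1)%N (prim_order_dvd zeta_prim).
Qed.

(** The phases of distinct edges are averaged independently, and the average of a
power of the phase over the q-th roots of unity is 0 unless the power is trivial. *)
Lemma average_phases (I : finType) (b : I -> K) (c : I -> int) :
  (forall e, b e != 0) -> (forall e, (q %| c e)%Z -> b e ^ c e = 1) ->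
  \sum_(t : {ffun I -> 'I_q}) \prod_e (zeta ^+ t e * b e) ^ c e =
  if [forall e, (q %| c e)%Z] then (q ^ #|I|)%:R else 0.
Proof.
move=> b0 bc.
rewrite -(bigA_distr_bigA (fun e (k : 'I_q) => (zeta ^+ k * b e) ^ c e)) /=.
have fct e : \sum_(k < q) (zeta ^+ k * b e) ^ c e = if (q %| c e)%Z then q%:R else 0.
  have -> : \sum_(k < q) (zeta ^+ k * b e) ^ c e = b e ^ c e * \sum_(k < q) (zeta ^ c e) ^+ k.
    rewrite mulr_sumr; apply: eq_bigr => k _.
    rewrite expfzMl mulrC; congr (_ * _).
    by rewrite !exprnP !exprz_exp mulrC.
  rewrite sum_unity_root; last first.
    by rewrite exprnP exprz_exp mulrC -exprz_exp -exprnP (prim_expr_order zeta_prim) exp1rz.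
  rewrite prim_exprz_eq1; case: ifP => [/bc ->|_]; first by rewrite mul1r.
  by rewrite mulr0.
rewrite (eq_bigr _ (fun e _ => fct e)); case: forallP => [H|H].
  by rewrite (eq_bigr (fun=> q%:R)) => [|e _]; rewrite ?H // prodr_const natrX.
have /existsP[e /negbTE He] : [exists e, ~~ (q %| c e)%Z].
  by rewrite -negb_forall; apply/forallP.
by rewrite (bigD1 e) //= He mul0r.
Qed.

End Average.

Section PrimitiveRoot.
Local Open Scope ring_scope.

Lemma prim_root_exists (K : closedFieldType) n :
  n%:R != 0 :> K -> exists z : K, n.-primitive_root z.
Proof.
move=> n0; have n_gt0 : (0 < n)%N by case: n n0 => //; rewrite eqxx.
pose p : {poly K} := 'X^n - 1; have [r Dp] := closed_field_poly_normal p.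
rewrite (monicP _) ?monicXnsubC // scale1r in Dp.
have rn1 : all n.-unity_root r by apply/allP => z; rewrite -root_prod_XsubC -Dp.
have sz_r : (n < (size r).+1)%N.
  by rewrite -(size_prod_XsubC r id) -Dp size_XnsubC.
have [|z] := hasP (has_prim_root n_gt0 rn1 _ sz_r); last by exists z.
by rewrite -separable_prod_XsubC -Dp separable_Xn_sub_1.
Qed.

End PrimitiveRoot.

(** * Measurability of matrix functions *)

Section ComplexMeasurable.
Local Open Scope ring_scope.
Context (R : realType) (d : measure_display) (T : measurableType d).
Implicit Types f g : T -> R[i].

Definition cmeasurable f :=
  measurable_fun setT (fun t => complex.Re (f t)) /\
  measurable_fun setT (fun t => complex.Im (f t)).

Lemma eq_cmeasurable f g : f =1 g -> cmeasurable f -> cmeasurable g.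
Proof. by move=> /funext ->. Qed.

Lemma cmeasurable_cst z : cmeasurable (fun=> z).
Proof. by split; apply: measurable_cst. Qed.

Lemma cmeasurableD f g :
  cmeasurable f -> cmeasurable g -> cmeasurable (fun t => f t + g t).
Proof.
move=> [fr fi] [gr gi]; split.
  by under eq_fun do rewrite raddfD; apply: measurable_funD.
by under eq_fun do rewrite raddfD; apply: measurable_funD.
Qed.

Lemma cmeasurableM f g :
  cmeasurable f -> cmeasurable g -> cmeasurable (fun t => f t * g t).
Proof.
move=> [fr fi] [gr gi]; split.
  rewrite (_ : (fun _ => _) = (fun t =>
    complex.Re (f t) * complex.Re (g t) - complex.Im (f t) * complex.Im (g t))).
    by apply: measurable_funB; apply: measurable_funM.
  by apply/funext => t; case: (f t) => a b; case: (g t).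
rewrite (_ : (fun _ => _) = (fun t =>
  complex.Re (f t) * complex.Im (g t) + complex.Im (f t) * complex.Re (g t))).
  by apply: measurable_funD; apply: measurable_funM.
by apply/funext => t; case: (f t) => a b; case: (g t).
Qed.

Lemma cmeasurableV f : cmeasurable f -> cmeasurable (fun t => (f t)^-1).
Proof.
move=> [fr fi].
pose n t := complex.Re (f t) ^+ 2 + complex.Im (f t) ^+ 2.
have mn : measurable_fun setT (fun t => (n t)^-1).
  rewrite (_ : (fun _ => _) = (@powR R ^~ (-1)) \o n).
    apply: measurableT_comp => //.
    by apply: measurable_funD; apply: measurable_funX.
  by apply/funext => t /=; rewrite powR_inv1// addr_ge0// sqr_ge0.
split.
  rewrite (_ : (fun _ => _) = (fun t => complex.Re (f t) * (n t)^-1)).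
    exact: measurable_funM.
  by apply/funext => t; rewrite /n; case: (f t).
rewrite (_ : (fun _ => _) = (fun t => - (complex.Im (f t) * (n t)^-1))).
  by apply: measurableT_comp => //; exact: measurable_funM.
by apply/funext => t; rewrite /n; case: (f t).
Qed.

Lemma cmeasurable_sum (I : Type) (s : seq I) (p : pred I) (F : I -> T -> R[i]) :
  (forall i, cmeasurable (F i)) -> cmeasurable (fun t => \sum_(i <- s | p i) F i t).
Proof.
move=> mF; elim: s => [|i s IHs].
  by apply: eq_cmeasurable (cmeasurable_cst 0) => t; rewrite big_nil.
case pi : (p i); last by apply: eq_cmeasurable IHs => t; rewrite big_cons pi.
by apply: eq_cmeasurable (cmeasurableD (mF i) IHs) => t; rewrite big_cons pi.
Qed.

Lemma cmeasurable_prod (I : Type) (s : seq I) (p : pred I) (F : I -> T -> R[i]) :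
  (forall i, cmeasurable (F i)) -> cmeasurable (fun t => \prod_(i <- s | p i) F i t).
Proof.
move=> mF; elim: s => [|i s IHs].
  by apply: eq_cmeasurable (cmeasurable_cst 1) => t; rewrite big_nil.
case pi : (p i); last by apply: eq_cmeasurable IHs => t; rewrite big_cons pi.
by apply: eq_cmeasurable (cmeasurableM (mF i) IHs) => t; rewrite big_cons pi.
Qed.

Lemma measurable_ceq f z : cmeasurable f -> measurable_fun setT (fun t => f t == z).
Proof.
move=> [fr fi].
rewrite (_ : (fun _ => _) = (fun t =>
  (complex.Re (f t) == complex.Re z) && (complex.Im (f t) == complex.Im z))).
  apply: measurable_and; apply: measurable_fun_eqr => //; exact: measurable_cst.
by apply/funext => t; rewrite eq_complex.
Qed.

Lemma cmeasurable_if (b : T -> bool) f g : measurable_fun setT b ->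
  cmeasurable f -> cmeasurable g -> cmeasurable (fun t => if b t then f t else g t).
Proof.
move=> mb [fr fi] [gr gi]; split.
  rewrite (_ : (fun _ => _) = (fun t => if b t then complex.Re (f t) else complex.Re (g t))).
    exact: measurable_fun_ifT.
  by apply/funext => t; case: ifP.
rewrite (_ : (fun _ => _) = (fun t => if b t then complex.Im (f t) else complex.Im (g t))).
  exact: measurable_fun_ifT.
by apply/funext => t; case: ifP.
Qed.

Section Matrices.
Variable N : nat.
Implicit Types F G : T -> 'M[R[i]]_N.

Definition mxmeasurable F := forall i j, cmeasurable (fun t => F t i j).

Lemma cmeasurable_det n (F : T -> 'M[R[i]]_n) :
  (forall i j, cmeasurable (fun t => F t i j)) -> cmeasurable (fun t => \det (F t)).
Proof.
move=> mF; apply: cmeasurable_sum => s.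
by apply: cmeasurableM; [exact: cmeasurable_cst|exact: cmeasurable_prod].
Qed.

Lemma mxmeasurableM F G :
  mxmeasurable F -> mxmeasurable G -> mxmeasurable (fun t => F t *m G t).
Proof.
move=> mF mG i j; apply: eq_cmeasurable (cmeasurable_sum (F := fun k t => F t i k * G t k j) _ _ _).
  by move=> t; rewrite mxE.
by move=> k; apply: cmeasurableM.
Qed.

Lemma mxmeasurableV F : mxmeasurable F -> mxmeasurable (fun t => invmx (F t)).
Proof.
move=> mF i j.
apply: (@eq_cmeasurable (fun t => if \det (F t) == 0 then F t i j
  else (\det (F t))^-1 * ((-1) ^+ (j + i) * \det (row' j (col' i (F t)))))).
  move=> t; rewrite /invmx unitmxE unitfE; case: eqP => //= _.
  by rewrite !mxE.
have mdet : cmeasurable (fun t => \det (F t)) by apply: cmeasurable_det.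
apply: cmeasurable_if => //; first exact: measurable_ceq.
apply: cmeasurableM; first exact: cmeasurableV.
apply: cmeasurableM; first exact: cmeasurable_cst.
apply: cmeasurable_det => k l.
by apply: eq_cmeasurable (mF (lift j k) (lift i l)) => t; rewrite !mxE.
Qed.

Lemma cmeasurable_trace F : mxmeasurable F -> cmeasurable (fun t => \tr (F t)).
Proof. by move=> mF; apply: cmeasurable_sum => i; apply: mF. Qed.

End Matrices.

End ComplexMeasurable.

Section MatrixBorel.
Local Open Scope classical_set_scope.
Local Open Scope ring_scope.
Context (R : realType) (N : nat).
Local Notation CM := (cmatrix R N).

Lemma entry_continuous (i j : 'I_N) : continuous (fun M : 'M[R[i]]_N => M i j).
Proof. exact: coord_continuous. Qed.

Lemma Re_continuous : continuous (fun z : R[i] => complex.Re z).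
Proof.
move=> z U /= /nbhs_ballP [e e0 eU].
apply/nbhs_ballP; exists (e%:C)%C; first by rewrite /= ltcR.
move=> y zy; apply: eU; move: zy; rewrite -!ball_normE /= => zy.
rewrite -raddfB -ltcR; apply: le_lt_trans zy; exact: normc_ge_Re.
Qed.

Lemma Im_continuous : continuous (fun z : R[i] => complex.Im z).
Proof.
have Im_le (z : R[i]) : (`|complex.Im z|%:C)%C <= `|z|.
  have -> : complex.Im z = - complex.Re (z * 'i%C).
    by case: z => a b; rewrite /= mulr0 mulr1 sub0r opprK.
  rewrite normrN; apply: le_trans (normc_ge_Re _) _.
  rewrite normrM [X in _ * X](_ : _ = 1) ?mulr1// normc_def /=.
  by rewrite expr0n expr1n add0r sqrtr1.
move=> z U /= /nbhs_ballP [e e0 eU].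
apply/nbhs_ballP; exists (e%:C)%C; first by rewrite /= ltcR.
move=> y zy; apply: eU; move: zy; rewrite -!ball_normE /= => zy.
rewrite -raddfB -ltcR; exact: le_lt_trans (Im_le _) zy.
Qed.

Lemma measurable_continuous_cmatrix (f : 'M[R[i]]_N -> R) :
  continuous f -> measurable_fun setT (f : CM -> R).
Proof.
move=> /continuousP cf; apply: (measurability _ (RGenOpens.measurableE R)).
move=> _ [_ [a [b ->] <-]]; rewrite setTI; apply: sub_sigma_algebra.
exact/cf/interval_open.
Qed.

Lemma cmeasurable_entry (i j : 'I_N) : cmeasurable (fun M : CM => M i j).
Proof.
split.
  apply: measurable_continuous_cmatrix => M.
  apply: (@continuous_comp _ _ _ (fun M : 'M[R[i]]_N => M i j) (fun z : R[i] => complex.Re z)).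
    exact: entry_continuous.
  exact: Re_continuous.
apply: measurable_continuous_cmatrix => M.
apply: (@continuous_comp _ _ _ (fun M : 'M[R[i]]_N => M i j) (fun z : R[i] => complex.Im z)).
  exact: entry_continuous.
exact: Im_continuous.
Qed.

Lemma mulmx_continuous (g : 'M[R[i]]_N) : continuous (fun M : 'M[R[i]]_N => g *m M).
Proof.
move=> M A [P M_P sPA].
suff : \forall M' \near nbhs M, forall ij : 'I_N * 'I_N,
    P ij.1 ij.2 ((g *m (M' : 'M[R[i]]_N)) ij.1 ij.2).
  by apply: filterS => M' H; apply: sPA => i j; exact: (H (i, j)).
apply: filter_forall => -[i j] /=.
have ct : continuous (fun M' : 'M[R[i]]_N => (g *m M') i j).
  rewrite (_ : (fun _ => _) = (fun M' : 'M[R[i]]_N => \sum_k g i k * M' k j)); last first.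
    by apply/funext => M'; rewrite mxE.
  apply: (@continuous_big (R[i]^o) _ +%R 0) => [|k _ M']; first exact: add_continuous.
  apply: (@cvgMl_tmp (R[i])).
    exact: (@nbhs_filter 'M[R[i]]_N M').
  exact: entry_continuous.
exact: (ct M _ (M_P i j)).
Qed.

Lemma measurable_mulmx (g : CM) : measurable_fun setT (fun M : CM => g *m M : CM).
Proof.
apply: (@measurability _ _ CM CM setT _ (@open 'M[R[i]]_N)) => // _ [B oB <-].
rewrite setTI; apply: sub_sigma_algebra; move: B oB.
by apply/continuousP; exact: mulmx_continuous.
Qed.

End MatrixBorel.

(** * Invariance of the joint law *)

Section JointLaw.
Local Open Scope classical_set_scope.
Local Open Scope ring_scope.
Context (R : realType) (N r : nat).
Local Notation CM := (cmatrix R N).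

(** The sets whose probability is prescribed by independence. They are stable under
intersection, so that they determine a law on the sigma-algebra they generate. *)
Definition cylinders : set (set ('I_r -> CM)) :=
  [set [set a : 'I_r -> CM | forall i, B i (a i)] | B in
    [set B : 'I_r -> set CM | forall i, measurable (B i)]].

Definition families := g_sigma_algebraType cylinders.

HB.instance Definition _ := Measurable.on families.

Definition translate (g a : families) : families := fun i => g i *m a i.

Lemma measurable_families d (T : measurableType d) (f : T -> families) :
  (forall i, measurable_fun setT (fun t => f t i : CM)) -> measurable_fun setT f.
Proof.
move=> mf; apply: (@measurability _ _ T families setT f cylinders) => //.
move=> _ [_ [B mB <-] <-]; rewrite setTI.
rewrite (_ : _ @^-1` _ = \big[setI/setT]_(i < r) ((fun t => f t i : CM) @^-1` B i)).
  apply: bigsetI_measurable => i _; rewrite -[X in measurable X]setTI.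
  exact: mf.
rewrite -bigcap_seq; apply/seteqP; split => [t Bt i _|t Bt i]; first exact: Bt.
by apply: Bt; rewrite /= mem_index_enum.
Qed.

Lemma measurable_component (i : 'I_r) :
  measurable_fun setT (fun a : families => a i : CM).
Proof.
move=> _ B mB; rewrite setTI; apply: sub_sigma_algebra.
exists (fun j => if j == i then B else setT) => /=.
  by move=> j; case: ifP => // _; exact: measurableT.
apply/seteqP; split => [a /(_ i)|a Ba j]; first by rewrite eqxx.
by case: eqP => // ->.
Qed.

Lemma measurable_translate g : measurable_fun setT (translate g).
Proof.
apply: measurable_families => i.
apply: (@measurableT_comp _ _ _ families CM CM (fun M : CM => g i *m M : CM)).
  exact: measurable_mulmx.
exact: measurable_component.
Qed.

Context (d : measure_display) (T : measurableType d) (P : probability T R).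
Context (G : set CM) (A : 'I_r -> {RV P >-> CM}).
Hypotheses (mG : measurable G) (GM : forall g h, G g -> G h -> G (g *m h)).
Hypothesis hA : haar_iid G A.

Definition joint (t : T) : families := fun i => A i t.

Lemma measurable_joint : measurable_fun setT joint.
Proof. by apply: measurable_families => i; exact: measurable_funP. Qed.

(** On a cylinder this is independence and the invariance of each law; a measure is
determined by its values on cylinders. *)
Lemma joint_invariant g E : (forall i, G (g i)) -> measurable E ->
  P ((translate g \o joint) @^-1` E) = P (joint @^-1` E).
Proof.
case: hA => haar ind Gg mE.
have mj := measurable_joint.
have mtj : measurable_fun setT (translate g \o joint).
  exact: measurableT_comp (measurable_translate g) mj.
apply: (@measure_unique _ R families cylinders (fun=> setT) _ _ _ _
  (pushforward P (translate g \o joint)) (pushforward P joint)) => //.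
- move=> _ _ [B mB <-] [C mC <-]; exists (fun i => B i `&` C i).
    by move=> i; apply: measurableI; [exact: mB|exact: mC].
  apply/seteqP; split => [a H|a [H K] i]; last by split.
  by split=> i; have [] := H i.
- move=> _; exists (fun=> setT) => [i|]; first exact: measurableT.
  by apply/seteqP; split.
- by rewrite bigcup_const//; exists 0%N.
- move=> _ [B mB <-]; rewrite /pushforward /=.
  pose B' i := [set M : CM | B i (g i *m M)].
  have mB' i : measurable (B' i).
    rewrite -[X in measurable X]setTI; exact: (@measurable_mulmx R N (g i)).
  transitivity (\prod_(i < r) P (A i @^-1` B' i))%E; first exact: (ind B' mB').
  transitivity (\prod_(i < r) P (A i @^-1` B i))%E; last by rewrite -(ind B mB).
  apply: eq_bigr => i _; by have [_ /(_ (g i) (B i) (Gg i) (mB i))] := haar i.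
- by move=> _; apply: le_lt_trans (ltry 1); exact: probability_le1 measurableT.
Qed.

Lemma joint_ae : P [set t | forall i, G (A i t)] = 1%E.
Proof.
case: hA => haar ind; rewrite (ind (fun=> G))// big1// => i _.
by have [] := haar i.
Qed.

Lemma bounded_integrable (f : T -> R) K : measurable_fun setT f ->
  (forall t, `|f t| <= K) -> P.-integrable setT (EFin \o f).
Proof.
move=> mf fK; apply: measurable_bounded_integrable => //.
  exact: le_lt_trans (probability_le1 _ measurableT) (ltry 1).
exists K; split; first exact: num_real.
by move=> x Kx t _; apply: le_trans (fK t) (ltW Kx).
Qed.

Lemma integral_translate g (f : families -> R) K : (forall i, G (g i)) ->
  measurable_fun setT f -> (forall a, `|f a| <= K) ->
  (\int[P]_t (f (translate g (joint t)))%:E = \int[P]_t (f (joint t))%:E)%E.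
Proof.
move=> Gg mf fK.
have mj := measurable_joint.
have mtj : measurable_fun setT (translate g \o joint).
  exact: measurableT_comp (measurable_translate g) mj.
have mEf : measurable_fun setT (EFin \o f) by apply/measurable_EFinP.
transitivity (\int[pushforward P (translate g \o joint)]_a (EFin \o f) a)%E.
  rewrite (integral_pushforward mtj) ?preimage_setT//.
  apply: (@bounded_integrable (f \o (translate g \o joint)) K) => [|t]; last exact: fK.
  exact: measurableT_comp.
transitivity (\int[pushforward P joint]_a (EFin \o f) a)%E; last first.
  rewrite (integral_pushforward mj) ?preimage_setT//.
  apply: (@bounded_integrable (f \o joint) K) => [|t]; last exact: fK.
  exact: measurableT_comp.
apply: eq_measure_integral => E mE _; exact: joint_invariant.
Qed.

(** All the translates of f have the same expectation, which is thus the mean of their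
sum c. *)
Lemma expectation_average (I : finType) (g : I -> families) (f : families -> R)
    K c : (forall k i, G (g k i)) -> measurable_fun setT f ->
  (forall a, (forall i, G (a i)) -> `|f a| <= K) ->
  (forall a, (forall i, G (a i)) -> \sum_k f (translate (g k) a) = c) ->
  #|I|%:R * fine 'E_P[f \o joint] = c.
Proof.
move=> Gg mf fK fc.
pose S : set families := [set a | forall i, G (a i)].
have mS : measurable S by apply: sub_sigma_algebra; exists (fun=> G).
(* Outside S, a null set, f may be unbounded. *)
pose f1 a := f a * \1_S a.
have mf1 : measurable_fun setT f1 by apply: measurable_funM.
have f1K a : `|f1 a| <= `|K|.
  rewrite /f1 indicE; case: (boolP (a \in S)) => [/set_mem aS|_].
    by rewrite mulr1; apply: le_trans (fK _ aS) (ler_norm _).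
  by rewrite mulr0 normr0.
have mj := measurable_joint.
have null : P.-negligible (~` (joint @^-1` S)).
  have mjS : measurable (joint @^-1` S) by rewrite -[X in measurable X]setTI; exact: mj.
  exists (~` (joint @^-1` S)); split => //; first exact: measurableC.
  by rewrite probability_setC// [X in (_ - X)%E](_ : _ = 1%E) ?subee//; exact: joint_ae.
have ae h1 h2 : (forall t, S (joint t) -> h1 t = h2 t) ->
    ae_eq P setT (EFin \o h1 : T -> \bar R) (EFin \o h2).
  move=> h12; apply: negligibleS null => t /= nh Sj; apply: nh => _.
  by rewrite /= h12.
have Ef : ('E_P[f \o joint] = \int[P]_t (f1 (joint t))%:E)%E.
  rewrite unlock; apply: ae_eq_integral => //.
  - by apply/measurable_EFinP; apply: measurableT_comp.
  - by apply/measurable_EFinP; exact: (measurableT_comp mf1 mj).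
  by apply: ae => t Sj; rewrite /f1 /= indicE mem_set// mulr1.
have int1 k : P.-integrable setT (fun t => (f1 (translate (g k) (joint t)))%:E).
  apply: (@bounded_integrable (f1 \o (translate (g k) \o joint)) `|K|) => [|t]; last exact: f1K.
  apply: measurableT_comp => //.
  exact: measurableT_comp (measurable_translate _) mj.
have fin : ('E_P[f \o joint])%E \is a fin_num.
  rewrite Ef; apply: integrable_fin_num => //.
  apply: (@bounded_integrable (f1 \o joint) `|K|) => [|t]; last exact: f1K.
  exact: measurableT_comp.
apply: EFin_inj; rewrite EFinM fineK//.
transitivity (\sum_(k : I) \int[P]_t (f1 (translate (g k) (joint t)))%:E)%E.
  rewrite (eq_bigr (fun=> ('E_P[f \o joint])%E)) => [|k _]; last first.
    by rewrite Ef (integral_translate (K := `|K|)).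
  by rewrite -(fineK fin) sumEFin sumr_const -[in RHS]mulr_natl EFinM.
rewrite -integral_sum//.
transitivity (\int[P]_t c%:E)%E; last first.
  rewrite integral_cst// [X in (_ * X)%E](_ : _ = 1%E) ?mule1//.
  exact: probability_setT.
under eq_integral do rewrite sumEFin.
apply: ae_eq_integral => //.
- apply/measurable_EFinP; apply: measurable_sum => k.
  have /integrableP[/measurable_EFinP] := int1 k; by [].
apply: ae => t Sj; rewrite -(fc _ Sj); apply: eq_bigr => k _.
by rewrite /f1 indicE mem_set ?mulr1// => i; apply: GM; [exact: Gg|exact: Sj].
Qed.

End JointLaw.

(** * The mean trace counts balanced loops *)

Section WreathMonomial.
Local Open Scope classical_set_scope.
Local Open Scope ring_scope.
Context (R : realType) (m : option nat) (N : nat).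
Local Notation CM := (cmatrix R N).

Definition phase (z : R[i]) : Prop :=
  `|z| = 1 /\ if m is Some k then z ^+ k = 1 else True.

Lemma phase_neq0 z : phase z -> z != 0.
Proof. by case=> z1 _; rewrite -normr_eq0 z1 oner_neq0. Qed.

Lemma phaseM y z : phase y -> phase z -> phase (y * z).
Proof.
case=> y1 ym [z1 zm]; split; first by rewrite normrM y1 z1 mulr1.
by case: m ym zm => // k yk zk; rewrite exprMn yk zk mulr1.
Qed.

Lemma wreath_monomial (M : CM) : wreath R m N M <->
  exists (z : 'I_N -> R[i]) (s : 'S_N), M = monomial z s /\ forall i, phase (z i).
Proof.
split=> [[row col nrm pow]|[z [s [-> zp]]]].
  have [f fP] := @boolp.choice _ _
    (fun i j => M i j != 0 /\ forall j', M i j' != 0 -> j = j') row.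
  have f_inj : injective f.
    move=> i i' ii'; have [k [_ ku]] := col (f i).
    by rewrite -(ku i (fP i).1) -(ku i') // ii'; exact: (fP i').1.
  exists (fun i => M i (f i)), (perm f_inj); split.
    apply/matrixP => i j; rewrite mxE permE; case: eqP => [<- //|fij].
    by apply/eqP; apply: contrapT => /negP /(fP i).2.
  move=> i; split; first exact/nrm/(fP i).1.
  by case: m pow => // k; apply; exact: (fP i).1.
have E i j : (monomial z s i j != 0) = (s i == j).
  rewrite mxE; case: (s i == j); rewrite ?eqxx // mulr1n.
  exact/phase_neq0/zp.
split.
- by move=> i; exists (s i); split=> [|j]; rewrite E // => /eqP.
- move=> j; exists (s^-1%g j); split; first by rewrite E permKV.
  by move=> i; rewrite E => /eqP <-; rewrite permK.
- by move=> i j; rewrite E mxE => ->; case: (zp i).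
have zpm i := (zp i).2; case: m zpm => // k zpm i j.
by rewrite E mxE => ->; rewrite mulr1n.
Qed.

Lemma wreathM (g h : CM) : wreath R m N g -> wreath R m N h -> wreath R m N (g *m h).
Proof.
move=> /wreath_monomial[y [s [-> yp]]] /wreath_monomial[z [t [-> zp]]].
apply/wreath_monomial; rewrite monomialM; do 2 eexists; split; first by [].
by move=> i; apply: phaseM.
Qed.

Lemma measurable_phase d (T : measurableType d) (f : T -> R[i]) :
  cmeasurable f -> measurable [set t | phase (f t)].
Proof.
move=> mf; pose n t := complex.Re (f t) ^+ 2 + complex.Im (f t) ^+ 2.
have -> : [set t | phase (f t)] =
    [set t | n t == 1] `&` [set t | is_true (if m is Some k then f t ^+ k == 1 else true)].
  have nE t : (`|f t| = 1) <-> n t == 1.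
    rewrite normc_def /n; split=> [[] /eqP h|/eqP ->]; last by rewrite sqrtr1.
    by move: h; rewrite -[X in _ == X]sqrtr1 eqr_sqrt // ?ler01 // addr_ge0 // sqr_ge0.
  apply/seteqP; split => t /= [] h1 h2; split; do ?[exact/nE]; case: m h2 => // k /eqP //.
have mb (b : T -> bool) : measurable_fun setT b -> measurable [set t | b t].
  by move=> mb; rewrite -[X in measurable X]setTI; exact: (mb measurableT [set true]).
apply: measurableI.
  apply: (mb (fun t => n t == 1)); apply: measurable_fun_eqr.
    by apply: measurable_funD; apply: measurable_funX; case: mf.
  exact: measurable_cst.
apply: (mb (fun t => if m is Some k then f t ^+ k == 1 else true)).
case: m => [k|]; last exact: measurable_cst.
apply: measurable_ceq; elim: k => [|k IHk]; first exact: cmeasurable_cst.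
by apply: eq_cmeasurable (cmeasurableM mf IHk) => t; rewrite exprS.
Qed.

(** For each of the finitely many permutations, the condition on a matrix concerns its
entries one by one. *)
Lemma measurable_wreath : measurable (wreath R m N : set CM).
Proof.
pose E (s : 'S_N) (ij : 'I_N * 'I_N) := [set M : CM |
  if s ij.1 == ij.2 then phase (M ij.1 ij.2) else M ij.1 ij.2 = 0].
have -> : wreath R m N = \big[setU/set0]_(s : 'S_N) \big[setI/setT]_ij E s ij.
  apply/seteqP; split => M.
    move=> /wreath_monomial[z [s [-> zp]]]; rewrite -bigcup_seq; exists s.
      by rewrite /= mem_index_enum.
    rewrite -bigcap_seq => -[i j] _; rewrite /E /= mxE.
    by case: (s i == j); rewrite ?mulr1n ?mulr0n.
  rewrite -bigcup_seq => -[s _]; rewrite -bigcap_seq => ME.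
  apply/wreath_monomial; exists (fun i => M i (s i)), s; split.
    apply/matrixP => i j; rewrite mxE.
    by have := ME (i, j) (mem_index_enum _); rewrite /E /=; case: eqP => [->|_ ->].
  by move=> i; have := ME (i, s i) (mem_index_enum _); rewrite /E /= eqxx.
apply: bigsetU_measurable => s _; apply: bigsetI_measurable => -[i j] _.
rewrite /E /=; case: (s i == j).
  by apply: measurable_phase; exact: cmeasurable_entry.
have := measurable_ceq 0 (@cmeasurable_entry R N i j).
move=> /(_ measurableT [set true]); rewrite setTI => /(_ _)/=.
rewrite (_ : _ @^-1` _ = [set M : CM | M i j = 0]); first exact.
by apply/seteqP; split => M /eqP.
Qed.

End WreathMonomial.

Section MeanTrace.
Local Open Scope classical_set_scope.
Local Open Scope ring_scope.
Context (R : realType) (r : nat) (m : option nat) (w : free_group 'I_r).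
Hypothesis hm : forall k, m = Some k -> (2 <= k)%N.

(* For infinite m, a crossing number is at most the length of w in absolute value, so it
is divisible by [(size w).+1] only if it is 0. *)
Let q := if m is Some k then k else (size w).+1.

Let q_gt0 : (0 < q)%N.
Proof. by rewrite /q; case: m hm => // k /(_ k erefl); case: k. Qed.

Let divides_byE (T : eqType) (u : T) vs e :
  divides_by m (crossing u vs w e) = (q %| crossing u vs w e)%Z.
Proof.
rewrite /q; case: m => //=; apply/eqP/idP => [->|]; first by rewrite dvdz0.
move=> /dvdzP[c cE]; apply/eqP; rewrite -absz_eq0.
have := crossing_le u vs w e; rewrite cE abszM /=.
case: `|c|%N => [|n] //; rewrite mulSn => le_n.
by have := leq_trans (leq_addr _ _) le_n; rewrite ltnn.
Qed.

Variable N : nat.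

Let balancedE (rho : 'I_r -> 'S_N) i :
  balanced m i (perm_walk rho i w) w =
  [forall e : 'I_r * 'I_N,
    (q %| crossing i (perm_walk rho i w) w (e.1, (e.2, rho e.1 e.2)))%Z].
Proof.
apply/balancedP/forallP => [H e|H [x [u v]]]; first by rewrite -divides_byE H.
rewrite divides_byE; case: (boolP ((x, (u, v)) \in edges i (perm_walk rho i w) w)).
  by move=> /perm_walk_edge /= <-; exact: (H (x, u)).
by move=> /crossing_notin ->; rewrite dvdz0.
Qed.

Local Notation CM := (cmatrix R N).

Lemma cmeasurable_word_trace : cmeasurable (fun a : families R N r =>
  \tr (subst_word 1%:M mulmx invmx (fun i => a i : 'M[R[i]]_N) w)).
Proof.
apply: cmeasurable_trace; rewrite /subst_word.
elim: (word w) => [|b s IHs].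
  move=> i j; apply: eq_cmeasurable (cmeasurable_cst _ (1%:M i j)) => a.
  by rewrite big_nil.
have mb : mxmeasurable (fun a : families R N r => a b.1 : 'M[R[i]]_N).
  move=> i j; have [h1 h2] := @cmeasurable_entry R N i j.
  have mc := @measurable_component R N r b.1.
  by split; [exact: measurableT_comp h1 mc|exact: measurableT_comp h2 mc].
have mb' : mxmeasurable (fun a : families R N r =>
    (if b.2 then invmx (a b.1 : 'M[R[i]]_N) else a b.1)).
  by case: b.2 => //; exact: mxmeasurableV.
move=> i j; apply: eq_cmeasurable (mxmeasurableM mb' IHs i j) => a.
by rewrite big_cons.
Qed.

Let wreath_choice (a : families R N r) : (forall x, wreath R m N (a x)) ->
  exists (z : 'I_r * 'I_N -> R[i]) (s : 'I_r -> 'S_N),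
    a = (fun x => monomial (fun u => z (x, u)) (s x)) /\ forall e, phase m (z e).
Proof.
move=> aG.
have ex x : exists p : ('I_N -> R[i]) * 'S_N,
    a x = monomial p.1 p.2 /\ forall i, phase m (p.1 i).
  by have /wreath_monomial[z [s H]] := aG x; exists (z, s).
have [zs zsP] := boolp.choice ex.
exists (fun e => (zs e.1).1 e.2), (fun x => (zs x).2); split => [|e].
  by apply/funext => x; have [] := zsP x.
have [_ zp] := zsP e.1; exact: zp.
Qed.

Let norm_phase_int (z : R[i]) (c : int) : phase m z -> `|z ^ c| = 1.
Proof.
case=> z1 _; case: c => n; first by rewrite -exprnP normrX z1 expr1n.
by rewrite NegzE -exprz_inv -exprnP normrX normfV z1 invr1 expr1n.
Qed.

Lemma word_trace_bounded (a : families R N r) : (forall x, wreath R m N (a x)) ->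
  `|\tr (subst_word 1%:M mulmx invmx (fun i => a i : 'M[R[i]]_N) w)| <= N%:R.
Proof.
move=> /wreath_choice[z [s [-> zp]]].
rewrite mxtrace_word_monomial => [|e]; last exact/phase_neq0/zp.
apply: le_trans (ler_norm_sum _ _ _) _.
rewrite (eq_bigr (fun=> 1)) => [|i _].
  rewrite sumr_const ler_nat; apply: leq_trans (max_card _) _.
  by rewrite card_ord.
by rewrite normr_prod big1 // => e _; exact/norm_phase_int/zp.
Qed.

Let I := ({ffun 'I_r * 'I_N -> 'I_q} * {ffun 'I_r -> 'S_N})%type.

Lemma card_translations : #|{: I}| = (q ^ #|{: 'I_r * 'I_N}| * N`! ^ r)%N.
Proof.
rewrite card_prod !card_ffun !card_ord; congr (_ * _ ^ _)%N.
by rewrite -card_Sn.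
Qed.

Let translation (zeta : R[i]) (k : I) : families R N r :=
  fun x => monomial (fun u => zeta ^+ k.1 (x, u)) (k.2 x).

(** By [average_phases], a walk that is not balanced contributes 0. The phases of a
cancel on the balanced ones, and its permutations disappear when the sum over the
permutations of the translations is reindexed. *)
Lemma sum_translates zeta (a : families R N r) : q.-primitive_root zeta ->
  (forall x, wreath R m N (a x)) ->
  \sum_(k : I) \tr (subst_word 1%:M mulmx invmx
     (fun i => translate (translation zeta k) a i : 'M[R[i]]_N) w) =
  (q ^ #|{: 'I_r * 'I_N}| * loop_count w m N)%:R.
Proof.
move=> zprim /wreath_choice[z [s [-> zp]]].
have zeta0 := zeta_neq0 zprim.
(* The permutation of the translate of [monomial (z x) (s x)] is [rho x * s x]. *)
pose sh (rho : {ffun 'I_r -> 'S_N}) : {ffun 'I_r -> 'S_N} := [ffun x => rho x * s x]%g.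
have sh_inj : injective sh.
  move=> rho rho' /ffunP eq_sh; apply/ffunP => x; have := eq_sh x.
  by rewrite !ffunE => /mulIg.
pose b (rho : {ffun 'I_r -> 'S_N}) (e : 'I_r * 'I_N) := z (e.1, ((s e.1)^-1%g (rho e.1 e.2))).
have bp rho e : phase m (b rho e) by exact: zp.
have trE k : \tr (subst_word 1%:M mulmx invmx
     (fun i => translate (translation zeta k)
       (fun x => monomial (fun u => z (x, u)) (s x)) i : 'M[R[i]]_N) w) =
   \sum_(i | foldl (perm_step (sh k.2)) i w == i)
     \prod_(e : 'I_r * 'I_N) (zeta ^+ k.1 e * b (sh k.2) e) ^
        crossing i (perm_walk (sh k.2) i w) w (e.1, (e.2, sh k.2 e.1 e.2)).
  rewrite -mxtrace_word_monomial; last first.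
    by move=> e; rewrite mulf_neq0 ?expf_neq0 //; apply: (phase_neq0 (bp _ _)).
  congr (\tr (subst_word _ _ _ _ _)); apply/funext => x.
  rewrite /translate /translation monomialM ffunE; congr monomial.
  by apply/funext => u; rewrite /b /= ffunE permM permK.
rewrite (eq_bigr _ (fun k _ => trE k)).
pose F (rho : {ffun 'I_r -> 'S_N}) (t : {ffun 'I_r * 'I_N -> 'I_q}) :=
  \sum_(i | foldl (perm_step rho) i w == i)
     \prod_(e : 'I_r * 'I_N) (zeta ^+ t e * b rho e) ^
        crossing i (perm_walk rho i w) w (e.1, (e.2, rho e.1 e.2)).
rewrite -(pair_bigA _ (fun t rho => F (sh rho) t)) /= exchange_big /=.
transitivity (\sum_rho \sum_t F rho t).
  by rewrite [RHS](reindex_inj sh_inj).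
pose Q := (q ^ #|{: 'I_r * 'I_N}|)%N.
transitivity (\sum_(rho : {ffun 'I_r -> 'S_N}) \sum_(i | balanced_loop w m (i, rho)) (Q%:R : R[i])).
  apply: eq_bigr => rho _; rewrite exchange_big /=.
  rewrite [RHS]big_mkcond [LHS]big_mkcond; apply: eq_bigr => i _.
  rewrite /balanced_loop /=; case: eqP => //= _; rewrite balancedE.
  rewrite (average_phases zprim) //.
  - by move=> e; apply: (phase_neq0 (bp _ _)).
  - move=> e; rewrite -divides_byE; case: (m) (bp rho e) => [k|] [_ bk] /=.
      by move=> /dvdzP[c ->]; rewrite mulrC -exprz_exp -exprnP bk exp1rz.
    by move=> /eqP ->; rewrite expr0z.
rewrite (exchange_big_dep xpredT) //= pair_big_dep /= sumr_const natrM mulr_natr; congr (_ *+ _).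
Qed.

Context (d : measure_display) (T : measurableType d) (P : probability T R).
Context (A : 'I_r -> {RV P >-> CM}).
Hypothesis hA : haar_iid (wreath R m N) A.

Theorem mean_trace_balanced_loops :
  mean_trace w A = (((loop_count w m N)%:R / (N`! ^ r)%:R : R)%:C)%C.
Proof.
have q_neq0 : q%:R != 0 :> R[i] by rewrite pnatr_eq0 -lt0n.
have [zeta zprim] := prim_root_exists q_neq0.
pose tr (a : families R N r) := \tr (subst_word 1%:M mulmx invmx (fun i => a i : 'M[R[i]]_N) w).
have [mRe mIm] : cmeasurable tr := cmeasurable_word_trace.
have Gg k i : wreath R m N (translation zeta k i).
  apply/wreath_monomial; do 2 eexists; split => [|u]; first by [].
  have zq : zeta ^+ q = 1 by exact: prim_expr_order.
  split.
    have := congr1 Num.norm zq; rewrite normrX normr1 => /eqP.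
    by rewrite pexpr_eq1 ?normr_ge0 // => /eqP z1; rewrite normrX z1 expr1n.
  move: (nat_of_ord (k.1 (i, u))) zq => n; rewrite /q; case: (m) => // k' zk.
  by rewrite exprAC zk expr1n.
have bd a : (forall i, wreath R m N (a i)) ->
    (`|complex.Re (tr a)| <= N%:R) /\ (`|complex.Im (tr a)| <= N%:R).
  move=> /word_trace_bounded; rewrite -/(tr a) normc_def => le_n.
  have {le_n} : Num.sqrt (complex.Re (tr a) ^+ 2 + complex.Im (tr a) ^+ 2) <= N%:R.
    by rewrite -lecR rmorph_nat.
  move=> le_n; split; apply: le_trans le_n; rewrite -sqrtr_sqr ler_sqrt ?addr_ge0 ?sqr_ge0 //.
    by rewrite lerDl sqr_ge0.
  by rewrite lerDr sqr_ge0.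
have cI : (#|{: I}|%:R : R) != 0.
  rewrite pnatr_eq0 card_translations -lt0n muln_gt0 !expn_gt0 q_gt0 fact_gt0 //.
pose S : nat := (q ^ #|{: 'I_r * 'I_N}| * loop_count w m N)%N.
have HRe := @expectation_average R N r d T P _ A (@measurable_wreath R m N) (@wreathM R m N) hA I
  (translation zeta) (fun a => complex.Re (tr a)) N%:R S%:R Gg mRe (fun a aG => (bd a aG).1).
have HIm := @expectation_average R N r d T P _ A (@measurable_wreath R m N) (@wreathM R m N) hA I
  (translation zeta) (fun a => complex.Im (tr a)) N%:R 0 Gg mIm (fun a aG => (bd a aG).2).
rewrite /mean_trace /complex_expectation.
have -> : fine 'E_P[fun t => complex.Re (tr (joint A t))] =
    ((loop_count w m N)%:R / (N`! ^ r)%:R : R).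
  apply: (mulfI cI); rewrite [LHS]HRe => [|a aG].
    rewrite card_translations !natrM -mulrA; congr (_ * _).
    by rewrite mulrCA mulfV ?mulr1 // -natrX pnatr_eq0 -lt0n expn_gt0 fact_gt0.
  have := congr1 (@complex.Re R) (sum_translates zprim aG).
  by rewrite raddf_sum (raddfMn (@complex.Re R)).
have -> : fine 'E_P[fun t => complex.Im (tr (joint A t))] = 0.
  apply: (mulfI cI); rewrite [LHS]HIm ?mulr0 // => a aG.
  have := congr1 (@complex.Im R) (sum_translates zprim aG).
  by rewrite raddf_sum (raddfMn (@complex.Im R)) /= mul0rn.
by [].
Qed.

End MeanTrace.

(** * The expansion of the mean trace *)

Local Open Scope classical_set_scope.
Local Open Scope ring_scope.

Section Assembly.
Variables (r : nat) (w : free_group 'I_r) (m : option nat).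
Let L := size w.
Implicit Type Q : L.-tuple 'I_L.+1.

Lemma chi_ninfty : (forall Q, ~~ admissible m Q) -> chi m w = -oo%E.
Proof.
move=> noQ; rewrite /chi; case: pselect => // ex; exfalso; case: (ex) => n /asboolP[H [sH rH KH]].
by have [Q adm _] := subgroup_pattern sH rH KH; have := noQ Q; rewrite adm.
Qed.

(** The least rank of a pattern is the least rank of a subgroup, and a subgroup of
least rank is the subgroup of its pattern. *)
Lemma chi_fin Q0 : admissible m Q0 -> exists n : nat,
  [/\ chi m w = (1 - n%:Z)%:E, forall Q, admissible m Q -> (n <= @pattern_rank r w Q)%N &
    Kwitness m w = (@pattern_group r w) @`
      [set` [pred Q | admissible m Q && (@pattern_rank r w Q == n)]]].
Proof.
move=> adm0; rewrite /Kwitness /chi; case: pselect => [ex|]; last first.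
  have [rk sG K _ _] := admissible_group adm0; case.
  by exists (@pattern_rank r w Q0); apply/asboolP; exists (@pattern_group r w Q0).
case: ex_minnP => n /asboolP _ n_min; exists n; split=> //.
  move=> Q adm; apply: n_min; apply/asboolP; have [rk sG K _ _] := admissible_group adm.
  by exists (@pattern_group r w Q).
apply/seteqP; split=> [H [sH KH [n' [rH [/eqP]]]]|_ [Q /andP[adm /eqP rkn] <-]].
  rewrite -subr_eq0 => /eqP en; have {en} en : n' = n by lia.
  rewrite {n'}en in rH.
  have [Q adm [le_n full]] := subgroup_pattern sH rH KH.
  have rkn : @pattern_rank r w Q = n.
    apply/eqP; rewrite eqn_leq le_n /=; apply: n_min; apply/asboolP.
    by have [rk sG K _ _] := admissible_group adm; exists (@pattern_group r w Q).
  by exists Q; [apply/andP; split; [|apply/eqP]|exact: full].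
have [rk sG K _ _] := admissible_group adm.
by split=> //; exists n; rewrite -{1}rkn.
Qed.

End Assembly.

Theorem theorem1p11 (R : realType) (r : nat) (w : free_group 'I_r)
  (m : option nat) (hm : forall k : nat, m = Some k -> (2 <= k)%N)
  (d : nat -> measure_display) (Omega : forall N : nat, measurableType (d N))
  (P : forall N : nat, probability (Omega N) R)
  (A : forall N : nat, 'I_r -> {RV (P N) >-> cmatrix R N})
  (hA : forall N : nat, haar_iid (wreath R m N) (A N)) :
  exists C : nat,
    [/\ (Kwitness m w #= `I_C)%card,
        exists2 c : R, 0 < c &
          \forall N \near \oo,
            `|mean_trace w (A N) - C%:R * epow N (chi m w)|
              <= c%:C%C * epow N (chi m w - 1)%E
      & chi m w = -oo%E -> forall N : nat, mean_trace w (A N) = 0].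
Proof.
pose L := size w.
have mtE N := mean_trace_balanced_loops w hm (hA N).
case: (pickP [pred Q : L.-tuple 'I_L.+1 | admissible m Q]) => [Q0 adm0|noQ]; last first.
  have {}noQ (Q : L.-tuple 'I_L.+1) : ~~ admissible m Q by apply/negbT/noQ.
  have mt0 N : mean_trace w (A N) = 0.
    by rewrite mtE (loop_count_eq0 N noQ) mul0r.
  exists 0%N; split=> //.
    rewrite II0 (_ : Kwitness m w = set0) ?card_eq00 //.
    apply/seteqP; split=> // H [_ _ [n [_]]]; rewrite (chi_ninfty noQ) //.
  exists 1 => //; exists 0%N => // N _.
  by rewrite mt0 (chi_ninfty noQ) /= mulr0 subrr normr0 mulr0.
have [n [chiE n_le KE]] := chi_fin adm0.
pose minimal := [pred Q : L.-tuple 'I_L.+1 | admissible m Q && (@pattern_rank r w Q == n)].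
exists #|minimal|; split; last by rewrite chiE.
  have inj : {in [set` minimal] &, injective (@pattern_group r w)}.
    move=> Q Q' /set_mem/andP[adm _] /set_mem/andP[adm' _].
    exact: (@pattern_group_inj r m w).
  rewrite KE; apply: card_eq_trans (inj_card_eq inj) _.
  apply/card_set_bijP; exists (fun Q => index Q (enum minimal)); split.
  - by move=> Q /= QM; rewrite cardE index_mem mem_enum.
  - move=> Q Q' /set_mem QM /set_mem QM' eq_i.
    by rewrite -(@nth_index _ Q0 Q (enum minimal)) ?mem_enum // eq_i nth_index ?mem_enum.
  move=> k /= lt_k; exists (nth Q0 (enum minimal) k).
    by have := mem_nth Q0 (_ : (k < size (enum minimal))%N); rewrite mem_enum -cardE; apply.
  by rewrite index_uniq ?enum_uniq // -cardE.
pose s := [seq Q <- index_enum (L.-tuple 'I_L.+1) | admissible m Q].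
(* The order of growth of the term of Q. *)
pose e (Q : L.-tuple 'I_L.+1) : int := (vertex_count Q)%:Z - (\sum_x edge_count Q x)%:Z.
have eE Q : admissible m Q -> e Q = 1 - (@pattern_rank r w Q)%:Z.
  move=> adm; have [_ _ _ rk _] := admissible_group adm.
  rewrite /e sum_edge_count.
  have arith (a b c : nat) : (a + b = c + 1)%N -> b%:Z - c%:Z = 1 - a%:Z by lia.
  exact: arith rk.
have le_e : all (fun Q => e Q <= 1 - n%:Z) s.
  apply/allP => Q; rewrite mem_filter => /andP[adm _]; rewrite eE // lerD2l lerN2 lez_nat.
  exact: n_le.
have [c [N0 [c_gt0 HN]]] := asymp_sum (pattern_term_asymp R) le_e.
exists c => //; exists (maxn N0 L) => // N /=; rewrite geq_max => /andP[/HN bound le_L].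
have cntE : count (fun Q => e Q == 1 - n%:Z) s = #|minimal|.
  rewrite -sum1_count big_filter_cond -sum1_card; apply: eq_bigl => Q.
  rewrite inE; apply: andb_id2l => adm; rewrite eE //.
  by apply/eqP/eqP; lia.
have sumE : \sum_(Q <- s) pattern_term R Q N =
    (loop_count w m N)%:R / (N`! ^ r)%:R :> R.
  by rewrite big_filter -loop_countE // card_ord.
rewrite cntE sumE in bound.
rewrite mtE chiE /= -!(rmorph_nat (real_complex R)) -!fmorphXz -!rmorphM -rmorphB.
by rewrite normc_def /= expr0n addr0 sqrtr_sqr lecR.
Qed.
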